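(* Let $\mathbb{G}=\mathbb{Z}_{\mathsf m_1}\times\cdots\times\mathbb{Z}_{\mathsf m_n}$ with $\mathsf m_i\mid\mathsf m_j$ for $i<j$, let $G=\mathbb{Z}_{m_1}\times\cdots\times\mathbb{Z}_{m_n}$ with $m_i=\mathsf m_i^2$, and let $\pi:G\to\mathbb{G}$ be the canonical epimorphism. (1) Let $\mathfrak{D}=\mathfrak{D}(\mathcal{D}_{\chi,E},\mathbf S,\mathbf X)$ be a root datum over $\mathbb{G}$, with associated sequence $\underline{\mathbf a}\in A$ and associated Yetter-Drinfeld module $V_{\mathfrak{D}}\in{}^G_G\mathcal{YD}^{\pi^*(\Phi_{\underline{\mathbf a}})}$. Then the Nichols algebra $\mathcal{B}(V_{\mathfrak{D}})$ is isomorphic to a Nichols algebra of diagonal type with arithmetic root system in ${}^{\mathbb{G}}_{\mathbb{G}}\mathcal{YD}^{\Phi_{\underline{\mathbf a}}}$ through the group epimorphism $\pi:G\to\mathbb{G}$. (2) Suppose $\mathcal{B}(V)$ is a Nichols algebra of diagonal type with arithmetic root system in ${}^{\mathbb{G}}_{\mathbb{G}}\mathcal{YD}^{\Phi_{\underline{\mathbf a}}}$ whose support group is $\mathbb{G}$. Then there exists a root datum $\mathfrak{D}$ over $\mathbb{G}$ such that $\mathcal{B}(V_{\mathfrak{D}})\cong\mathcal{B}(V)$ through the group epimorphism $\pi:G\to\mathbb{G}$.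
   Context: **Cocycles.** $\mathbf{k}$ is an algebraically closed field of characteristic zero; $\zeta_t=e^{2\pi i/t}$ (so $\zeta_{st}^s=\zeta_t$); $[x]$ is the integer part. $\mathsf g_i$ (resp. $g_i$) is a generator of $\mathbb{Z}_{\mathsf m_i}$ (resp. $\mathbb{Z}_{m_i}$), and $\pi(g_i)=\mathsf g_i$. $\iota:\mathbb{G}\to G$ is the set-theoretic section $\prod\mathsf g_i^{i_i}\mapsto\prod g_i^{i_i}$ ($0\le i_i<\mathsf m_i$). $A$ is the set of integer sequences $\underline{\mathbf a}=((a_l),(a_{st})_{s<t},(a_{rst})_{r<s<t})$, indices in $\{1,\dots,n\}$, with $0\le a_l<\mathsf m_l$, $0\le a_{st}<\gcd(\mathsf m_s,\mathsf m_t)$, $0\le a_{rst}<\gcd(\mathsf m_r,\mathsf m_s,\mathsf m_t)$. For $0\le i_l,j_l,k_l<\mathsf m_l$, $$\Phi_{\underline{\mathbf a}}\big(\textstyle\prod\mathsf g_l^{i_l},\prod\mathsf g_l^{j_l},\prod\mathsf g_l^{k_l}\big)=\prod_{l}\zeta_{\mathsf m_l}^{a_li_l[\frac{j_l+k_l}{\mathsf m_l}]}\prod_{s<t}\zeta_{\mathsf m_t}^{a_{st}i_t[\frac{j_s+k_s}{\mathsf m_s}]}\prod_{r<s<t}\zeta_{(\mathsf m_r,\mathsf m_s,\mathsf m_t)}^{-a_{rst}k_rj_si_t}.$$ Throughout $\Phi_{\underline{\mathbf a}}$ is assumed to be abelian, i.e. its twisted quantum double is commutative, which amounts to $a_{rst}=0$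 for all $r<s<t$. $\pi^*(\Phi_{\underline{\mathbf a}})$ is the pull-back to $G$. Define $J_{\underline{\mathbf a}}:G\times G\to\mathbf{k}^*$ by $J_{\underline{\mathbf a}}(\prod g_l^{x_l},\prod g_l^{y_l})=\prod_l\zeta_{m_l}^{a_lx_l(y_l-y_l')}\prod_{s<t}\zeta_{\mathsf m_s\mathsf m_t}^{a_{st}x_t(y_s-y_s')}$ ($0\le x_i,y_i<m_i$), $y_i'$ being the remainder of $y_i$ modulo $\mathsf m_i$. **Yetter-Drinfeld modules.** For a finite abelian group $H$ and normalized $3$-cocycle $\Phi$ on $H$ put $\widetilde\Phi_g(e,f)=\frac{\Phi(g,e,f)\Phi(e,f,g)}{\Phi(e,g,f)}$. An object of ${}^H_H\mathcal{YD}^\Phi$ is an $H$-graded space $V=\bigoplus_g{}^gV$ (coaction $\delta_L(v)=g\otimes v$ for $v\in{}^gV$) with maps $e\triangleright:{}^gV\to{}^gV$ ($1\triangleright v=v$) satisfying $e\triangleright(f\triangleright v)=\widetilde\Phi_g(e,f)(ef)\triangleright v$ for $v\in{}^gV$. It is a braided tensor category: degrees multiply, $x\triangleright(m\otimes n)=\widetilde\Phi_x(g,h)\,x\triangleright m\otimes x\triangleright n$ for $m,n$ of degrees $g,h$; associativity $(u\otimes v)\otimes w\mapsto\Phi(e,f,g)^{-1}u\otimes(v\otimes w)$ for degrees $e,f,g$; braiding $u\otimes v\mapsto e\triangleright v\otimes u$. If $\Phi=1$ we write ${}^H_H\mathcal{YD}$ and speak of usual Nichols algebras. $V$ is diagonal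 (of diagonal type) if each ${}^gV$ is a direct sum of one-dimensional projective representations; a canonical basis consists of one nonzero homogeneous vector from each one-dimensional summand. The support group of $V$ and of $\mathcal{B}(V)$ is the subgroup generated by the degrees of a canonical basis. All $V$ are finite-dimensional. **Nichols algebras.** $T_\Phi(V)$ is the tensor algebra of $V$ in ${}^H_H\mathcal{YD}^\Phi$, a graded Hopf algebra in the category with elements of $V$ primitive; $\mathcal{B}(V)=T_\Phi(V)/I$ with $I$ the unique maximal graded Hopf ideal generated by homogeneous elements of degree $\ge2$. Given $V\in{}^H_H\mathcal{YD}^\Phi$ and $U\in{}^{H_1}_{H_1}\mathcal{YD}^\Psi$ with support groups $H'$, $H_1'$, we say $\mathcal{B}(V)$ is isomorphic to $\mathcal{B}(U)$ through the group morphism $f$ if $f:H'\to H_1'$ is an epimorphism and there is a linear isomorphism $F:V\to U$ with $\delta_L\circ F=(f\otimes F)\circ\delta_L$, $F(g\triangleright v)=f(g)\triangleright F(v)$ for $g\in H'$, and $\Phi|_{H'}=f^*(\Psi|_{H_1'})$ (such a pair induces an isomorphism $\mathcal{B}(V)\to\mathcal{B}(U)$ preserving multiplication and comultiplication). **Arithmetic root systems.** Let $\chi$ be a bicharacter on $\mathbb{Z}^d$ with values in $\mathbf{k}^*$, $E=\{e_1,\dots,e_d\}$ a basis. For a basis $F=\{f_1,\dots,f_d\}$ and $i\ne j$ let $m_{ij}$ be the least $m\ge0$ with $(1+q+\cdots+q^m)(q^m\chi(f_i,f_j)\chi(f_j,f_i)-1)=0$, $q=\chi(f_i,f_i)$,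 if it exists; when all $m_{ij}$ exist the reflection $s_{i,F}$ is $f_i\mapsto-f_i$, $f_j\mapsto f_j+m_{ij}f_i$. The Weyl groupoid $W_{\chi,E}$ is generated by these reflections starting from $E$; it is full if all reflections at all bases obtained from $E$ are defined. For a usual diagonal $\mathcal{B}(V)$ with canonical basis $X_i$ of degree $h_i$ and $h_i\triangleright X_j=q_{ij}X_j$, put $\chi(e_i,e_j)=q_{ij}$; $\triangle^+$ is the set of $\mathbb{Z}^d$-degrees of the restricted Poincaré-Birkhoff-Witt generators and $\triangle=\triangle^+\cup-\triangle^+$. If $W_{\chi,E}$ is full and finite, $\triangle_{\chi,E}=(\triangle,\chi,E)$ is an arithmetic root system. Its generalized Dynkin diagram $\mathcal{D}_{\chi,E}$ has vertices $1,\dots,d$ labelled $q_{ii}=\chi(e_i,e_i)$ and an edge labelled $\widetilde{q_{ij}}=\chi(e_i,e_j)\chi(e_j,e_i)$ whenever $i\neq j$, $\widetilde{q_{ij}}\ne1$; the $q_{ii},\widetilde{q_{ij}}$ are its structure constants. For $V\in{}^{\mathbb{G}}_{\mathbb{G}}\mathcal{YD}^{\Phi_{\underline{\mathbf a}}}$ let $\widetilde V=V$ with coaction $(\iota\otimes\mathrm{id})\delta_L$ and action $g\blacktriangleright Z=\pi(g)\triangleright Z$, an object of ${}^G_G\mathcal{YD}^{\pi^*(\Phi_{\underline{\mathbf a}})}$, and let $V'=\widetilde V^{J_{\underline{\mathbf a}}^{-1}}$, where for a $2$-cochain $J$ the module $W^J$ is $W$ with action $g\triangleright_JX=\frac{J(g,x)}{J(x,g)}g\triangleright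 X$ for $X$ of degree $x$. The arithmetic root system of $\mathcal{B}(V)$ is by definition that of the usual Nichols algebra $\mathcal{B}(V')\in{}^G_G\mathcal{YD}$. **Root data.** Let $\mathcal{D}_{\chi,E}$ be the generalized Dynkin diagram of an arithmetic root system with $m$ vertices and structure constants $q_{ii},\widetilde{q_{ij}}$. A root datum $\mathfrak{D}(\mathcal{D}_{\chi,E},\mathbf S,\mathbf X)$ over $\mathbb{G}$ consists of integer matrices $\mathbf S=(s_{ij})_{m\times n}$, $0\le s_{ij}<m_j$, and $\mathbf X=(x_{ij})_{n\times m}$, $0\le x_{ij}<m_i$, such that: there is an integer matrix $\mathbf T=(t_{ij})_{n\times m}$ with $(\mathbf T\mathbf S)_{jk}\equiv\delta_{jk}\pmod{m_k}$ (that is, with $h_l=\prod_kg_k^{s_{lk}}$ one has $g_j=\prod_lh_l^{t_{jl}}$); $q_{ii}=\prod_{k=1}^n\zeta_{m_k}^{s_{ik}x_{ki}}$ and $\widetilde{q_{ij}}=\prod_{k=1}^n\zeta_{m_k}^{s_{ik}x_{kj}+s_{jk}x_{ki}}$; and $\sum_{j=1}^mx_{ij}t_{lj}\equiv0\pmod{\mathsf m_i}$ for $1\le l<i\le n$. The associated sequence $\underline{\mathbf a}\in A$ is given by $a_i\equiv\sum_jx_{ij}t_{ij}\pmod{\mathsf m_i}$, $a_{il}\equiv\frac{\mathsf m_l}{\mathsf m_i}\sum_jx_{ij}t_{lj}\pmod{\mathsf m_l}$ for $i<l$, and $a_{ilt}=0$. $V_{\mathfrak{D}}\in{}^G_G\mathcal{YD}^{\pi^*(\Phi_{\underline{\mathbf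 a}})}$ has canonical basis $X_1,\dots,X_m$ with $\delta_L(X_j)=h_j\otimes X_j$ and $g_i\blacktriangleright X_j=\zeta_{m_i}^{x_{ij}}\frac{J_{\underline{\mathbf a}}(g_i,h_j)}{J_{\underline{\mathbf a}}(h_j,g_i)}X_j$.
   Formalization: The congruences defining the associated sequence are required for every admissible T, not just one (otherwise (1) is false), and ''with arithmetic root system'' includes that V' is an object of the untwisted category over G, which can fail (m=(2,4), a_12=1). *)

(* Defs.v *)
From HB Require Import structures.
From mathcomp Require Import all_boot all_order all_algebra all_fingroup.
Set Implicit Arguments.
Unset Strict Implicit.
Unset Printing Implicit Defensive.
Import GRing.Theory.
Local Open Scope ring_scope.

(** ** Yetter-Drinfeld modules over finite abelian groups *)

(* The coaction is encoded by its homogeneous components,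
     delta_L v = \sum_g g (x) yd_coact V g v,
   so that v has degree g iff yd_coact V g v = v. *)
Record yd_data (k : fieldType) (H : finGroupType) := YDData {
  yd_space :> vectType k;
  yd_coact : H -> 'End(yd_space);
  yd_act : H -> 'End(yd_space) }.

Arguments YDData {k H} yd_space yd_coact yd_act.
Arguments yd_coact {k H} V g : rename.
Arguments yd_act {k H} V g : rename.

Section YetterDrinfeld.
Variables (k : fieldType) (H : finGroupType).
Implicit Types (Phi : H -> H -> H -> k) (J : H -> H -> k) (V : yd_data k H).

Definition tilde Phi (g e f : H) : k :=
  Phi g e f * Phi e f g / Phi e g f.

(* Membership in the category of Yetter-Drinfeld modules twisted by Phi.
   The first two conditions say that yd_coact is a grading, the fourth that
   the action preserves degrees (H is abelian). *)
Record is_YD Phi V : Prop := IsYD {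
  yd_coassoc : forall x y (v : V),
    yd_coact V x (yd_coact V y v) = if x == y then yd_coact V y v else 0;
  yd_counit : forall v : V, \sum_x yd_coact V x v = v;
  yd_act1 : forall v : V, yd_act V 1%g v = v;
  yd_act_deg : forall e g (v : V), yd_coact V g (yd_act V e v) = yd_act V e (yd_coact V g v);
  yd_actM : forall e f g (v : V), yd_coact V g v = v ->
    yd_act V e (yd_act V f v) = tilde Phi g e f *: yd_act V (e * f)%g v }.

Definition trivial_cocycle : H -> H -> H -> k := fun _ _ _ => 1.

Definition canonical_basis V d (h : 'I_d -> H) (X : d.-tuple V) : Prop :=
  [/\ basis_of fullv X,
      forall j, yd_coact V (h j) (tnth X j) = tnth X j
    & forall g j, yd_act V g (tnth X j) \in <[tnth X j]>%VS].

Definition is_diagonal V : Prop :=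
  exists d (h : 'I_d -> H) (X : d.-tuple V), canonical_basis h X.

Definition is_support V (D : {set H}) : Prop :=
  exists d (h : 'I_d -> H) (X : d.-tuple V),
    canonical_basis h X /\ D = <<[set h j | j : 'I_d]>>%g.

(* The module W^J, for a 2-cochain J. *)
Definition twist J V : yd_data k H :=
  YDData V (yd_coact V)
    (fun g => \sum_x (J g x / J x g) *: (yd_act V g \o yd_coact V x)%VF).

(* The twisted quantum double has basis (e_g x), with product
   (e_g x)(e_h y) = delta_{g,h} tilde Phi g x y (e_g xy); no conjugation
   occurs since H is abelian. *)
Definition tqd_mul Phi (u v : {ffun H * H -> k}) : {ffun H * H -> k} :=
  [ffun p => \sum_x \sum_(y | (x * y)%g == p.2)
     tilde Phi p.1 x y * u (p.1, x) * v (p.1, y)].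

Definition abelian_cocycle Phi : Prop := commutative (tqd_mul Phi).

End YetterDrinfeld.

Arguments trivial_cocycle {k H}.

(** ** Isomorphisms of Nichols algebras through a group morphism *)

(* B(V) is isomorphic to B(U) through f. By definition this is a condition on
   the generating objects (V, Phi) and (U, Psi): the domain D of f is the
   support group of V, its image that of U. *)
Definition nichols_iso_through (k : fieldType) (H H1 : finGroupType)
    (D : {group H}) (f : {morphism D >-> H1})
    (Phi : H -> H -> H -> k) (V : yd_data k H)
    (Psi : H1 -> H1 -> H1 -> k) (U : yd_data k H1) : Prop :=
  [/\ is_support V D,
      is_support U (f @* D)%g,
      exists F : 'Hom(V, U),
        [/\ bijective F,
            forall y v,
              yd_coact U y (F v) = \sum_(x in D | f x == y) F (yd_coact V x v)
          & forall g v, g \in D -> F (yd_act V g v) = yd_act U (f g) (F v)]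
    & {in D & D & D, forall x y z, Phi x y z = Psi (f x) (f y) (f z)}].

(** ** Arithmetic root systems and generalized Dynkin diagrams *)

(* A basis of Z^d is the matrix in GL_d(Z) whose rows are its elements. *)
Section ArithmeticRootSystems.
Variables (k : fieldType) (d : nat).
Implicit Types (chi : 'rV[int]_d -> 'rV[int]_d -> k) (E F T : 'M[int]_d).

Definition bicharacter chi : Prop :=
  [/\ forall u v w, chi (u + v) w = chi u w * chi v w,
      forall u v w, chi u (v + w) = chi u v * chi u w
    & forall u v, chi u v != 0].

Definition cartan_cond chi F i j (m : nat) : Prop :=
  let q := chi (row i F) (row i F) in
  (\sum_(l < m.+1) q ^+ l)
    * (q ^+ m * chi (row i F) (row j F) * chi (row j F) (row i F) - 1) = 0.

(* m_{ij} exists and is m *)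
Definition cartan_entry chi F i j (m : nat) : Prop :=
  cartan_cond chi F i j m /\
  forall m', cartan_cond chi F i j m' -> (m <= m')%N.

(* The reflection s_{i,F} is defined and maps the basis F to F'. *)
Definition reflects chi F i F' : Prop :=
  row i F' = - row i F /\
  forall j, j != i -> exists2 m, cartan_entry chi F i j m
                               & row j F' = row j F + row i F *+ m.

(* (T, F) stands for the automorphism u |-> u *m T of Z^d, viewed as an arrow
   from the basis F to the basis F *m T. *)
Inductive weyl_groupoid chi E : 'M[int]_d -> 'M[int]_d -> Prop :=
| Weyl_start : weyl_groupoid chi E 1%:M E
| Weyl_base F i F' : weyl_groupoid chi E 1%:M F -> reflects chi F i F' ->
    weyl_groupoid chi E 1%:M F'
| Weyl_refl F i F' : weyl_groupoid chi E 1%:M F -> reflects chi F i F' ->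
    weyl_groupoid chi E (invmx F *m F') F
| Weyl_comp T1 T2 F : weyl_groupoid chi E T2 F ->
    weyl_groupoid chi E T1 (F *m T2) -> weyl_groupoid chi E (T2 *m T1) F
| Weyl_inv T F : weyl_groupoid chi E T F ->
    weyl_groupoid chi E (invmx T) (F *m T).

Definition weyl_full chi E : Prop :=
  forall F i, weyl_groupoid chi E 1%:M F -> exists F', reflects chi F i F'.

Definition weyl_finite chi E : Prop :=
  exists s : seq ('M[int]_d * 'M[int]_d),
    forall T F, weyl_groupoid chi E T F -> (T, F) \in s.

(* The root set is omitted from the triple: it is determined by (chi, E). *)
Definition arithmetic_root_system chi E : Prop :=
  [/\ bicharacter chi, E \in unitmx, weyl_full chi E & weyl_finite chi E].

(* edge_label i j = None means that there is no edge between i and j. *)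
Record gen_dynkin := GenDynkin {
  vertex_label : 'I_d -> k;
  edge_label : 'I_d -> 'I_d -> option k }.

Definition dynkin_diagram chi E : gen_dynkin :=
  let q i j := chi (row i E) (row j E) in
  GenDynkin (fun i => q i i)
    (fun i j => if (i != j) && (q i j * q j i != 1)
                then Some (q i j * q j i) else None).

(* the structure constant \widetilde{q_ij}, for i != j *)
Definition edge_const (D : gen_dynkin) i j : k := odflt 1 (edge_label D i j).

Definition bichar_of_matrix (q : 'I_d -> 'I_d -> k) :
    'rV[int]_d -> 'rV[int]_d -> k :=
  fun u v => \prod_i \prod_j q i j ^ (u 0 i * v 0 j).

End ArithmeticRootSystems.

(* The usual diagonal Nichols algebra B(W) has an arithmetic root system. *)
Definition usual_arithmetic (k : fieldType) (H : finGroupType)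
    (W : yd_data k H) : Prop :=
  exists d (h : 'I_d -> H) (X : d.-tuple W) (q : 'I_d -> 'I_d -> k),
    [/\ canonical_basis h X,
        forall i j, yd_act W (h i) (tnth X j) = q i j *: tnth X j
      & arithmetic_root_system (bichar_of_matrix q) 1%:M].

(** ** Products of cyclic groups *)

(* Z_{M_1} x ... x Z_{M_n} for positive M_i, with the componentwise group law;
   x stands for \prod_i g_i ^ x_i with 0 <= x_i < M_i. *)
Notation cyc n M :=
  {dffun forall i : 'I_n, 'I_(M i).-1.+1}.

Section CyclicProducts.
Variable n : nat.

(* \prod_i g_i ^ s_i *)
Definition of_exps (M s : 'I_n -> nat) : cyc n M := [ffun i => inZp (s i)].

Definition gen (M : 'I_n -> nat) (i : 'I_n) : cyc n M :=
  of_exps M (fun j => (j == i) : nat).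

Variable mm : 'I_n -> nat.

Definition sqm (i : 'I_n) : nat := (mm i ^ 2)%N.

Definition pi_fun (x : cyc n sqm) : cyc n mm := of_exps mm (fun i => x i : nat).

Definition iota_sec (x : cyc n mm) : cyc n sqm :=
  of_exps sqm (fun i => x i : nat).

Lemma pi_funM : {in [set: cyc n sqm] &, {morph pi_fun : x y / (x * y)%g}}.
Proof.
move=> x y _ _; apply/ffunP => i; rewrite !ffunE.
apply: val_inj => /=.
have mdvd : ((mm i).-1.+1 %| (sqm i).-1.+1)%N.
  rewrite /sqm; case: (mm i) => [//|m].
  by rewrite [X in (_ %| X)%N]prednK ?expn_gt0 // dvdn_exp.
by rewrite modnDm modn_dvdm.
Qed.

Definition pi_mor : {morphism [set: cyc n sqm] >-> cyc n mm} :=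
  Morphism pi_funM.

End CyclicProducts.

(** ** The 3-cocycles Phi_a and the 2-cochains J_a *)

Definition compatible_roots (k : fieldType) (zeta : nat -> k) : Prop :=
  (forall t, (0 < t)%N -> t.-primitive_root (zeta t)) /\
  (forall s t, (0 < s)%N -> (0 < t)%N -> zeta (s * t)%N ^+ s = zeta t).

(* Only the values a2 s t for s < t and a3 r s t for r < s < t are used. *)
Record cocycle_seq (n : nat) := CocycleSeq {
  a1 : 'I_n -> nat;
  a2 : 'I_n -> 'I_n -> nat;
  a3 : 'I_n -> 'I_n -> 'I_n -> nat }.

Definition in_A n (mm : 'I_n -> nat) (a : cocycle_seq n) : Prop :=
  [/\ forall l, (a1 a l < mm l)%N,
      forall s t : 'I_n, (s < t)%N -> (a2 a s t < gcdn (mm s) (mm t))%N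
    & forall r s t : 'I_n, (r < s)%N -> (s < t)%N ->
        (a3 a r s t < gcdn (gcdn (mm r) (mm s)) (mm t))%N].

Section Cocycles.
Variables (k : fieldType) (zeta : nat -> k) (n : nat) (mm : 'I_n -> nat).
Variable a : cocycle_seq n.

Definition Phi_a (x y z : cyc n mm) : k :=
  (\prod_l zeta (mm l) ^+ (a1 a l * x l * ((y l + z l) %/ mm l)))
  * (\prod_(s : 'I_n) \prod_(t : 'I_n | (s < t)%N)
       zeta (mm t) ^+ (a2 a s t * x t * ((y s + z s) %/ mm s)))
  * (\prod_(r : 'I_n) \prod_(s : 'I_n | (r < s)%N) \prod_(t : 'I_n | (s < t)%N)
       zeta (gcdn (gcdn (mm r) (mm s)) (mm t)) ^- (a3 a r s t * z r * y s * x t)).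

Definition pi_Phi (x y z : cyc n (sqm mm)) : k :=
  Phi_a (pi_mor mm x) (pi_mor mm y) (pi_mor mm z).

Definition J_a (x y : cyc n (sqm mm)) : k :=
  (\prod_l zeta (sqm mm l) ^+ (a1 a l * x l * (y l - y l %% mm l)))
  * (\prod_(s : 'I_n) \prod_(t : 'I_n | (s < t)%N)
       zeta (mm s * mm t) ^+ (a2 a s t * x t * (y s - y s %% mm s))).

Definition lift_yd (V : yd_data k (cyc n mm)) : yd_data k (cyc n (sqm mm)) :=
  YDData V (fun g => \sum_(x | iota_sec x == g) yd_coact V x)
    (fun g => yd_act V (pi_mor mm g)).

(* V' = (\widetilde V)^{J_a^{-1}} *)
Definition untwist (V : yd_data k (cyc n mm)) : yd_data k (cyc n (sqm mm)) :=
  twist (fun x y => (J_a x y)^-1) (lift_yd V).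

(* The arithmetic root system of B(V) is that of B(V'), which is only a usual
   Nichols algebra if V' is an object of the untwisted category. *)
Definition nichols_arithmetic (V : yd_data k (cyc n mm)) : Prop :=
  is_YD trivial_cocycle (untwist V) /\ usual_arithmetic (untwist V).

End Cocycles.

(** ** Root data *)

Section RootData.
Variables (k : fieldType) (zeta : nat -> k) (n : nat) (mm : 'I_n -> nat).

(* The conditions on T in a root datum: with h_l = \prod_k g_k ^ S_lk one has
   g_j = \prod_l h_l ^ T_jl, and \sum_j x_ij t_lj = 0 mod mm_i for l < i. *)
Definition admissible d (S : 'M[nat]_(d, n)) (X : 'M[nat]_(n, d))
    (T : 'M[int]_(n, d)) : Prop :=
  (forall j l, (\sum_i T j i * (S i l)%:Z == (j == l)%:Z %[mod (sqm mm l)%:Z])%Z)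
  /\ (forall l i : 'I_n, (l < i)%N ->
        (\sum_j (X i j)%:Z * T l j == 0 %[mod (mm i)%:Z])%Z).

Record root_datum := RootDatum {
  rd_rank : nat;
  rd_diagram : gen_dynkin k rd_rank;
  rd_S : 'M[nat]_(rd_rank, n);
  rd_X : 'M[nat]_(n, rd_rank);
  rd_arithmetic : exists chi E,
    arithmetic_root_system chi E /\ rd_diagram = dynkin_diagram chi E;
  rd_S_lt : forall i j, (rd_S i j < sqm mm j)%N;
  rd_X_lt : forall i j, (rd_X i j < sqm mm i)%N;
  rd_T : exists T, admissible rd_S rd_X T;
  rd_vertex : forall i,
    vertex_label rd_diagram i
      = \prod_l zeta (sqm mm l) ^+ (rd_S i l * rd_X l i);
  rd_edge : forall i j, i != j ->
    edge_const rd_diagram i j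
      = \prod_l zeta (sqm mm l) ^+ (rd_S i l * rd_X l j + rd_S j l * rd_X l i) }.

(* For the associated sequence to make sense, the right-hand sides must not
   depend on the choice of T; this is not automatic when the rank exceeds n. *)
Record associated_seq (D : root_datum) (a : cocycle_seq n) : Prop :=
  AssociatedSeq {
  assoc_in_A : in_A mm a;
  assoc_a1 : forall T, admissible (rd_S D) (rd_X D) T -> forall i,
    ((a1 a i)%:Z == \sum_j (rd_X D i j)%:Z * T i j %[mod (mm i)%:Z])%Z;
  assoc_a2 : forall T, admissible (rd_S D) (rd_X D) T -> forall i l : 'I_n,
    (i < l)%N ->
    ((a2 a i l)%:Z == (mm l %/ mm i)%N%:Z * \sum_j (rd_X D i j)%:Z * T l j
       %[mod (mm l)%:Z])%Z;
  assoc_a3 : forall i l t : 'I_n, (i < l)%N -> (l < t)%N -> a3 a i l t = 0%N }.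

Definition rd_h (D : root_datum) (j : 'I_(rd_rank D)) : cyc n (sqm mm) :=
  of_exps (sqm mm) (rd_S D j).

(* W is a copy of V_D. *)
Definition is_V_D (D : root_datum) (a : cocycle_seq n)
    (W : yd_data k (cyc n (sqm mm))) : Prop :=
  is_YD (pi_Phi zeta a) W /\
  exists X : (rd_rank D).-tuple W,
    canonical_basis (rd_h (D:=D)) X /\
    forall i j, yd_act W (gen (sqm mm) i) (tnth X j)
      = (zeta (sqm mm i) ^+ rd_X D i j
         * (J_a zeta a (gen (sqm mm) i) (rd_h j)
            / J_a zeta a (rd_h j) (gen (sqm mm) i))) *: tnth X j.

End RootData.

(* Main.v *)
Require Import Defs.
From HB Require Import structures.
From mathcomp Require Import all_boot all_order all_algebra all_fingroup.
From mathcomp Require Import all_solvable.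
From mathcomp Require Import zify ring.
Set Implicit Arguments.
Unset Strict Implicit.
Unset Printing Implicit Defensive.
Import GRing.Theory.
Local Open Scope ring_scope.

(** Let g_s denote the generators. When the a_rst vanish, the cocycle and the
    cochain are governed by one character beta_s of the group for each s, namely
    the one with beta_s(g_s) = zeta_{mm s}^{a_s}, beta_s(g_t) = zeta_{mm t}^{a_st}
    for t > s and beta_s(g_t) = 1 for t < s. Indeed Phi_a(x, y, z) is the product of
    the beta_s(x) raised to the carry of y_s + z_s modulo mm s (Phi_betaE), and
    J_a(x, y) that of the beta_s(x) raised to the quotient of y_s by mm s
    (J_betaE). Hence J_a(h, -) trivializes the pulled back cocycle as soon as all
    beta_s(h) ^ mm s are 1 (J_mulr).

    Both directions rest on the relation

       (R)   zeta_{mm i} ^ x_ij = beta_i(h_j)    for all i and j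

    between the matrix X and the degrees h_j. It implies beta_i(h_j) ^ mm i = 1, so
    that untwisting by J_a yields honest characters, and it says that the element
    g_i ^ mm i of the kernel of pi acts trivially on X_j. If the matrix T writes
    the g_l in terms of the h_j, then applying (R) to this expression shows that
    the product over j of the zeta_{mm i} ^ (x_ij t_lj) is beta_i(g_l); for l < i,
    l = i and l > i this is the congruence required of a root datum and the two
    congruences that define the associated sequence (beta_exp_of_T).

    From a root datum to a module. The congruences hold for all admissible T.
    Comparing two choices of T gives (R) (X_kernel, X_beta_of_T). The action on V_D
    is then well defined and factors through pi, and V is V_D regraded along pi. The
    untwisted module has the same generalized Dynkin diagram as the root datum,
    but possibly another bicharacter. Since Weyl groupoids depend on the
    bicharacter only through the quadratic form u |-> chi u u, which the diagram
    determines, its root system is arithmetic (arithmetic_of_diagram).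

    From a module to a root datum. Untwisting V gives characters of the large
    group on a canonical basis; X records their values at the generators, S the
    lifted degrees. Computing the action of g_i ^ mm i in two ways gives (R). The
    lifted degrees still generate, as the kernel of pi lies in the Frattini
    subgroup (lift_generates), whence T. The module V_D is the lift of V, and
    commutativity of the twisted quantum double kills the a_rst (a3_abelian). *)

(** * Arithmetic root systems are determined by their Dynkin diagrams *)

Lemma edge_const_dynkin (k : fieldType) d (chi : 'rV[int]_d -> 'rV[int]_d -> k)
    (E : 'M[int]_d) i j : i != j ->
  edge_const (dynkin_diagram chi E) i j
    = chi (row i E) (row j E) * chi (row j E) (row i E).
Proof.
by rewrite /edge_const /= => ->; case: eqP => //= ->.
Qed.

(** Label functions are compared pointwise, which needs no extensionality. *)
Definition same_diagram (k : fieldType) d (D1 D2 : gen_dynkin k d) : Prop :=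
  (forall i, vertex_label D1 i = vertex_label D2 i) /\
  (forall i j, i != j -> edge_const D1 i j = edge_const D2 i j).

Section DynkinTransfer.
Variables (k : fieldType) (d : nat).
Implicit Types (chi : 'rV[int]_d -> 'rV[int]_d -> k) (E F P T : 'M[int]_d).

Lemma charM_trivial (f : 'rV[int]_d -> k) :
  (forall u v, f (u + v) = f u * f v) -> (forall u, f u != 0) ->
  (forall i, f (delta_mx 0 i) = 1) -> forall u, f u = 1.
Proof.
move=> fD f_neq0 f_delta u.
have f0 : f 0 = 1.
  by apply: (mulfI (f_neq0 0)); rewrite -fD addr0 mulr1.
have fN v : f v = 1 -> f (- v) = 1.
  by move=> fv; rewrite -[LHS]mul1r -{1}fv -fD subrr f0.
have fMn v m : f v = 1 -> f (v *+ m) = 1.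
  by move=> fv; elim: m => [|m IHm]; rewrite ?mulr0n // mulrS fD fv IHm mulr1.
rewrite [u]row_sum_delta.
apply: (big_ind (fun v => f v = 1)) => // [v w fv fw|i _].
  by rewrite fD fv fw mulr1.
rewrite -[u 0 i]intz scaler_int.
by case: (u 0 i) => m; rewrite ?NegzE ?mulrNz -pmulrn; [|apply: fN]; apply: fMn.
Qed.

(** In coordinates, the ratio psi of the two bicharacters is alternating on the
    basis, hence everywhere; so u |-> psi u u is multiplicative, and it is trivial
    on the basis. *)
Lemma diagram_quadratic_form chi1 E1 chi2 E2 :
  bicharacter chi1 -> bicharacter chi2 ->
  same_diagram (dynkin_diagram chi1 E1) (dynkin_diagram chi2 E2) ->
  forall u, chi1 (u *m E1) (u *m E1) = chi2 (u *m E2) (u *m E2).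
Proof.
move=> [chi1Dl chi1Dr chi1_neq0] [chi2Dl chi2Dr chi2_neq0] [eqV eqE] u.
pose psi u v := chi1 (u *m E1) (v *m E1) / chi2 (u *m E2) (v *m E2).
have psi_neq0 v w : psi v w != 0 by rewrite mulf_neq0 ?invr_neq0.
have psiDl v w t : psi (v + w) t = psi v t * psi w t.
  by rewrite /psi !mulmxDl chi1Dl chi2Dl invfM mulrACA.
have psiDr v w t : psi v (w + t) = psi v w * psi v t.
  by rewrite /psi !mulmxDl chi1Dr chi2Dr invfM mulrACA.
have psi_diag i : psi (delta_mx 0 i) (delta_mx 0 i) = 1.
  by have := eqV i; rewrite /psi -!rowE /= => ->; rewrite divff.
have psi_alt i j : psi (delta_mx 0 i) (delta_mx 0 j)
                   * psi (delta_mx 0 j) (delta_mx 0 i) = 1.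
  have [->|neq_ij] := eqVneq i j; first by rewrite psi_diag mulr1.
  have := eqE i j neq_ij; rewrite !edge_const_dynkin // /psi -!rowE mulrACA -invfM.
  by move=> ->; rewrite divff ?mulf_neq0.
have psi_sym v w : psi v w * psi w v = 1.
  move: v; apply: charM_trivial => [v t|v|i].
  - by rewrite psiDl psiDr mulrACA.
  - by rewrite mulf_neq0.
  move: w; apply: charM_trivial => [v t|v|j] //.
  - by rewrite psiDl psiDr mulrACA.
  - by rewrite mulf_neq0.
have : psi u u = 1.
  apply: (charM_trivial (f := fun v => psi v v)) => // v w.
  by rewrite psiDl !psiDr -mulrA (mulrA (psi v w)) psi_sym mul1r.
by move/(canRL (mulfVK (chi2_neq0 _ _))); rewrite mul1r.
Qed.

(** Polarization at u + v. *)
Lemma bichar_sym_of_quadratic chi1 chi2 P :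
  bicharacter chi1 -> bicharacter chi2 ->
  (forall u, chi1 u u = chi2 (u *m P) (u *m P)) ->
  forall u v, chi1 u v * chi1 v u
              = chi2 (u *m P) (v *m P) * chi2 (v *m P) (u *m P).
Proof.
move=> [chi1Dl chi1Dr chi1_neq0] [chi2Dl chi2Dr chi2_neq0] eqQ u v.
have := eqQ (u + v); rewrite mulmxDl !chi1Dl !chi1Dr !chi2Dl !chi2Dr -!eqQ.
rewrite !mulrA -!(mulrA (chi1 u u)) => /(mulfI (chi1_neq0 u u)).
by move/(mulIf (chi1_neq0 v v)).
Qed.

Lemma reflects_unitmx chi F i F' :
  F \in unitmx -> reflects chi F i F' -> F' \in unitmx.
Proof.
move=> uF [rowi rowj].
(* row i F = - row i F', hence row j F = row j F' + m * row i F' *)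
have [c rowFE] : exists c : 'I_d -> 'rV[int]_d, forall j, row j F = c j *m F'.
  apply: (fin_all_exists (P := fun j c => row j F = c *m F')) => j.
  have [->|neq_ji] := eqVneq j i.
    by exists (- delta_mx 0 i); rewrite mulNmx -rowE rowi opprK.
  have [m _ rowjE] := rowj j neq_ji.
  exists (delta_mx 0 j + delta_mx 0 i *+ m).
  by rewrite mulmxDl -scaler_nat -scalemxAl -!rowE scaler_nat rowjE rowi mulNrn addrK.
have FE : F = (\matrix_j c j) *m F'.
  by apply/row_matrixP => j; rewrite row_mul rowK rowFE.
by move: uF; rewrite {1}FE unitmx_mul => /andP[].
Qed.

(** Needed because invmx is the identity on matrices that are not invertible, so
    that it is compatible with a change of basis only on the others. *)
Lemma weyl_groupoid_unitmx chi E T F : E \in unitmx ->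
  weyl_groupoid chi E T F -> (T \in unitmx) && (F \in unitmx).
Proof.
move=> uE; elim=> {T F} [|F i F' _ /andP[_ uF] rF|F i F' _ /andP[_ uF] rF
  |T1 T2 F _ /andP[uT2 uF] _ /andP[uT1 _]|T F _ /andP[uT uF]].
- by rewrite unitmx1.
- by rewrite unitmx1 (reflects_unitmx uF rF).
- by rewrite unitmx_mul unitmx_inv uF (reflects_unitmx uF rF).
- by rewrite unitmx_mul uT1 uT2.
- by rewrite unitmx_inv unitmx_mul uT uF.
Qed.

Lemma reflects_transfer chi1 chi2 P F i F' :
  bicharacter chi1 -> bicharacter chi2 ->
  (forall u, chi1 u u = chi2 (u *m P) (u *m P)) ->
  reflects chi1 F i F' -> reflects chi2 (F *m P) i (F' *m P).
Proof.
move=> chi1P chi2P eqQ [rowi rowj]; split; first by rewrite !row_mul rowi mulNmx.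
have condE j m : cartan_cond chi2 (F *m P) i j m <-> cartan_cond chi1 F i j m.
  rewrite /cartan_cond !row_mul -!mulrA -(bichar_sym_of_quadratic chi1P chi2P) //.
  by rewrite -eqQ.
move=> j /rowj[m [cond_m min_m] rowjE]; exists m.
  by split=> [|m' /condE]; [apply/condE | apply: min_m].
by rewrite !row_mul rowjE mulmxDl -!scaler_nat -scalemxAl.
Qed.

(** In the second basis, F becomes F *m P, so the arrows, which act on the right,
    are conjugated by P. *)
Lemma weyl_groupoid_transfer chi1 chi2 P E T F :
  bicharacter chi1 -> bicharacter chi2 -> E \in unitmx -> P \in unitmx ->
  (forall u, chi1 u u = chi2 (u *m P) (u *m P)) ->
  weyl_groupoid chi1 E T F ->
  weyl_groupoid chi2 (E *m P) (invmx P *m T *m P) (F *m P).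
Proof.
move=> chi1P chi2P uE uP eqQ.
have conjP1 : invmx P *m 1%:M *m P = 1%:M by rewrite mulmx1 mulVmx.
have invM A B : A \in unitmx -> B \in unitmx ->
    invmx (A *m B) = invmx B *m invmx A :> 'M[int]_d.
  move=> uA uB; have uAB : A *m B \in unitmx by rewrite unitmx_mul uA uB.
  by rewrite -[RHS](mulmxK uAB) -!mulmxA mulKmx // mulKmx // mul1mx.
elim=> {T F} [|F i F' _ IH rF|F i F' wF IH rF|T1 T2 F _ IH2 _ IH1|T F wT IH].
- by rewrite conjP1; apply: Weyl_start.
- rewrite conjP1 in IH *; apply: Weyl_base IH _.
  exact: reflects_transfer rF.
- rewrite conjP1 in IH; have /andP[_ uF] := weyl_groupoid_unitmx uE wF.
  have := Weyl_refl IH (reflects_transfer chi1P chi2P eqQ rF).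
  by rewrite invM // !mulmxA.
- have -> : invmx P *m (T2 *m T1) *m P
      = (invmx P *m T2 *m P) *m (invmx P *m T1 *m P).
    by rewrite !mulmxA mulmxK.
  by apply: Weyl_comp => //; rewrite !mulmxA mulmxK // -!mulmxA mulmxA.
- have /andP[uT uF] := weyl_groupoid_unitmx uE wT.
  have := Weyl_inv IH; rewrite -mulmxA !invM ?unitmx_mul ?unitmx_inv ?uT //.
  by rewrite invmxK !mulmxA mulmxK.
Qed.

(** The reflections only involve chi through the quadratic form u |-> chi u u,
    so the change of basis from E1 to E2 identifies the two Weyl groupoids. *)
Lemma arithmetic_of_diagram chi1 E1 chi2 E2 :
  bicharacter chi2 -> E2 \in unitmx ->
  same_diagram (dynkin_diagram chi1 E1) (dynkin_diagram chi2 E2) ->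
  arithmetic_root_system chi1 E1 -> arithmetic_root_system chi2 E2.
Proof.
move=> chi2P uE2 eqD [chi1P uE1 full1 [s s_fin]].
pose P := invmx E1 *m E2; pose Q := invmx E2 *m E1.
have [uP uQ] : P \in unitmx /\ Q \in unitmx.
  by rewrite !unitmx_mul !unitmx_inv uE1 uE2.
have E2Q : E2 *m Q = E1 by rewrite mulKVmx.
have QP : Q *m P = 1%:M by rewrite -mulmxA mulKVmx ?mulVmx.
have eqQ u : chi1 u u = chi2 (u *m P) (u *m P).
  have := diagram_quadratic_form chi1P chi2P eqD (u *m invmx E1).
  by rewrite mulmxKV // -!mulmxA.
have eqQ' u : chi2 u u = chi1 (u *m Q) (u *m Q) by rewrite eqQ -mulmxA QP mulmx1.
have back T F : weyl_groupoid chi2 E2 T F ->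
    weyl_groupoid chi1 E1 (invmx Q *m T *m Q) (F *m Q).
  by rewrite -E2Q; apply: weyl_groupoid_transfer.
clearbody P Q; split=> // [F i /back|].
  rewrite mulmx1 mulVmx // => /(full1 _ i)[F' rF].
  have := reflects_transfer chi1P chi2P eqQ rF.
  by rewrite -mulmxA QP mulmx1; exists (F' *m P).
exists [seq (Q *m TF.1 *m invmx Q, TF.2 *m P) | TF <- s] => T F /back /s_fin sTF.
apply/mapP; exists (invmx Q *m T *m Q, F *m Q) => //=.
by rewrite !mulmxA mulmxV // mul1mx mulmxK // -(mulmxA F) QP mulmx1.
Qed.

Lemma bichar_of_matrixP (q : 'I_d -> 'I_d -> k) :
  (forall i j, q i j != 0) -> bicharacter (bichar_of_matrix q).
Proof.
move=> q_neq0.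
have uq i j : q i j \is a GRing.unit by rewrite unitfE.
split=> [u v w|u v w|u v].
- rewrite /bichar_of_matrix -big_split; apply: eq_bigr => i _.
  rewrite -big_split; apply: eq_bigr => j _ /=.
  by rewrite mxE mulrDl exprzDr.
- rewrite /bichar_of_matrix -big_split; apply: eq_bigr => i _.
  rewrite -big_split; apply: eq_bigr => j _ /=.
  by rewrite mxE mulrDr exprzDr.
- by apply/prodf_neq0 => i _; apply/prodf_neq0 => j _; rewrite expfz_neq0.
Qed.

Lemma bichar_of_matrix_basis (q : 'I_d -> 'I_d -> k) i j :
  bichar_of_matrix q (row i 1%:M) (row j 1%:M) = q i j.
Proof.
rewrite /bichar_of_matrix (bigD1 i) //= [X in _ * X]big1 => [|a neq_ai]; last first.
  by rewrite big1 // => b _; rewrite !mxE eq_sym (negPf neq_ai) mul0r expr0z.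
rewrite mulr1 (bigD1 j) //= [X in _ * X]big1 => [|b neq_bj]; last first.
  by rewrite !mxE [j == b]eq_sym (negPf neq_bj) mulr0 expr0z.
by rewrite !mxE !eqxx !mulr1 expr1z.
Qed.

End DynkinTransfer.

(** * Diagonal Yetter-Drinfeld modules as families of degrees and scalars *)

Section Diagonal.
Variables (k : fieldType) (H : finGroupType).
Implicit Types (Phi : H -> H -> H -> k) (J : H -> H -> k) (V : yd_data k H).

(** A canonical basis with its degrees h and the scalars lam by which H acts.
    Unlike canonical_basis it determines V completely, so that every condition
    on V can be read off from h and lam. *)
Record diag_pres V d (h : 'I_d -> H) (X : d.-tuple V) (lam : H -> 'I_d -> k)
  : Prop := DiagPres {
  pres_basis : basis_of fullv X;
  pres_coact : forall x j,
    yd_coact V x (tnth X j) = if x == h j then tnth X j else 0;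
  pres_act : forall g j, yd_act V g (tnth X j) = lam g j *: tnth X j }.

Lemma basis_tnth_neq0 (vT : vectType k) d (X : d.-tuple vT) j :
  basis_of fullv X -> tnth X j != 0.
Proof.
move=> /basis_free/free_not0 /(_ (mem_tnth j X)) XjN0; exact: XjN0.
Qed.

Lemma basis_scaleI (vT : vectType k) d (X : d.-tuple vT) j (a b : k) :
  basis_of fullv X -> a *: tnth X j = b *: tnth X j -> a = b.
Proof.
move=> basX /eqP; rewrite -subr_eq0 -scalerBl scaler_eq0.
by rewrite (negPf (basis_tnth_neq0 j basX)) orbF subr_eq0 => /eqP.
Qed.

Lemma basis_lin_ind (vT : vectType k) d (X : d.-tuple vT) (P : vT -> Prop) :
  basis_of fullv X -> P 0 -> (forall a u v, P u -> P v -> P (a *: u + v)) ->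
  (forall j, P (tnth X j)) -> forall v, P v.
Proof.
move=> basX P0 PD PX v; rewrite (coord_basis basX (memvf v)).
elim/big_rec: _ => // j u _ Pu; apply: PD => //.
by rewrite -tnth_nth.
Qed.

Lemma canonical_pres V Phi d (h : 'I_d -> H) (X : d.-tuple V) :
  is_YD Phi V -> canonical_basis h X ->
  diag_pres h X (fun g j => coord X j (yd_act V g (tnth X j))).
Proof.
move=> ydV [basX degX actX]; split=> // [x j|g j].
  by rewrite -degX (yd_coassoc ydV) degX; case: eqP => // ->.
have /vlineP[a ->] := actX g j; rewrite linearZ /= {2}(tnth_nth 0).
by rewrite coord_free ?(basis_free basX) // eqxx mulr1.
Qed.

Lemma twist_act J V x v g :
  (forall y, yd_coact V y v = if y == x then v else 0) ->
  yd_act (twist J V) g v = (J g x / J x g) *: yd_act V g v.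
Proof.
move=> cov; rewrite /= sum_lfunE (bigD1 x) //= big1 => [|y neq_y].
  by rewrite addr0 !lfunE /= lfunE /= cov eqxx.
by rewrite !lfunE /= lfunE /= cov (negPf neq_y) !linear0.
Qed.

Section Presented.
Variables (V : yd_data k H) (d : nat) (h : 'I_d -> H) (X : d.-tuple V).
Variable lam : H -> 'I_d -> k.
Hypothesis presV : diag_pres h X lam.

Lemma pres_canonical : canonical_basis h X.
Proof.
case: presV => basX coX actX; split=> // [j|g j]; first by rewrite coX eqxx.
by rewrite actX memvZ ?memv_line.
Qed.

Lemma pres_YD Phi :
  (forall j, lam 1%g j = 1) ->
  (forall e f j, lam e j * lam f j = tilde Phi (h j) e f * lam (e * f)%g j) ->
  is_YD Phi V.
Proof.
case: presV => basX coX actX lam1 lamM.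
have coactK x y v :
    yd_coact V x (yd_coact V y v) = if x == y then yd_coact V y v else 0.
  move: v; apply: (basis_lin_ind basX) => [|a u v IHu IHv|j].
  - by rewrite !linear0 if_same.
  - by rewrite !linearP /= IHu IHv; case: ifP => // _; rewrite scaler0 addr0.
  - rewrite coX; have [->|_] := eqVneq y (h j); first exact: coX.
    by rewrite linear0 if_same.
split=> // [v|v|e g v|e f g v].
- move: v; apply: (basis_lin_ind basX) => [|a u v IHu IHv|j].
  + by rewrite big1 // => x _; rewrite linear0.
  + rewrite -[in RHS]IHu -[in RHS]IHv scaler_sumr -big_split /=.
    by apply: eq_bigr => x _; rewrite linearP.
  + rewrite (bigD1 (h j)) //= coX eqxx big1 ?addr0 // => x /negPf neq_x.
    by rewrite coX neq_x.
- move: v; apply: (basis_lin_ind basX) => [|a u v IHu IHv|j]; first by rewrite linear0.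
    by rewrite linearP /= IHu IHv.
  by rewrite actX lam1 scale1r.
- move: v; apply: (basis_lin_ind basX) => [|a u v IHu IHv|j]; first by rewrite !linear0.
    by rewrite !linearP /= IHu IHv.
  by rewrite actX linearZ /= coX; case: ifP => _; rewrite ?actX // !linear0.
- move=> <-; move: v; apply: (basis_lin_ind basX) => [|a u v IHu IHv|j].
  + by rewrite !linear0.
  + by rewrite !linearP /= IHu IHv.
  rewrite coX; case: eqP => [->|_]; last by rewrite !linear0.
  by rewrite actX linearZ /= !actX !scalerA mulrC lamM.
Qed.

Lemma YD_pres Phi : is_YD Phi V ->
  (forall j, lam 1%g j = 1) /\
  (forall e f j, lam e j * lam f j = tilde Phi (h j) e f * lam (e * f)%g j).
Proof.
case: presV => basX coX actX [_ _ act1 _ actM].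
split=> [j|e f j]; apply: (basis_scaleI (j := j) basX).
  by rewrite scale1r -actX act1.
have := actM e f (h j) (tnth X j); rewrite !coX eqxx => /(_ erefl).
by rewrite !actX linearZ /= !actX !scalerA mulrC => ->.
Qed.

(** The right-hand side shows that the degrees, hence the support group, do not
    depend on the canonical basis. *)
Lemma pres_degrees : [set h j | j : 'I_d] = [set x | yd_coact V x != 0].
Proof.
case: presV => basX coX actX; apply/setP => x; rewrite inE.
apply/imsetP/idP => [[j _ ->]|coxN0].
  apply: contraNneq (basis_tnth_neq0 j basX) => co0.
  by have := coX (h j) j; rewrite eqxx co0 lfunE /= => <-.
have [j /eqP->|noj] := pickP (fun j => x == h j); first by exists j.
case/eqP: coxN0; apply/lfunP => v; rewrite lfunE /=.
move: v; apply: (basis_lin_ind basX) => [|a u v IHu IHv|j]; first exact: linear0.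
  by rewrite linearP /= IHu IHv scaler0 addr0.
by rewrite coX noj.
Qed.

Lemma pres_support : is_support V <<[set h j | j : 'I_d]>>%g.
Proof. by exists d, h, X; split=> //; apply: pres_canonical. Qed.

Lemma pres_twist J :
  diag_pres (V := twist J V) h X (fun g j => J g (h j) / J (h j) g * lam g j).
Proof.
case: presV => basX coX actX; split=> // g j.
by rewrite (@twist_act _ _ (h j)) => [|y]; rewrite ?coX // actX scalerA.
Qed.

End Presented.

Lemma pres_ext V d (h h' : 'I_d -> H) (X : d.-tuple V) lam mu :
  (forall j, h j = h' j) -> (forall g j, lam g j = mu g j) ->
  diag_pres h X lam -> diag_pres h' X mu.
Proof.
move=> eq_h eq_lam [basX coX actX]; split=> // [x j|g j].
  by rewrite -eq_h.
by rewrite -eq_lam.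
Qed.

Lemma support_unique V Phi d (h : 'I_d -> H) (X : d.-tuple V) lam (D : {set H}) :
  is_YD Phi V -> diag_pres h X lam -> is_support V D ->
  <<[set h j | j : 'I_d]>>%g = D.
Proof.
move=> ydV presV [d' [h' [X' [/(canonical_pres ydV) presV' ->]]]].
by rewrite (pres_degrees presV) (pres_degrees presV').
Qed.

Lemma pres_exists d (h : 'I_d -> H) (lam : H -> 'I_d -> k) :
  exists (V : yd_data k H) (X : d.-tuple V), diag_pres h X lam.
Proof.
pose diag (c : 'I_d -> k) : 'End('rV[k]_d) := linfun (mulmxr (diag_mx (\row_j c j))).
pose X := [tuple delta_mx (0 : 'I_1) j : 'rV[k]_d | j < d].
have diagX c j : diag c (tnth X j) = c j *: tnth X j.
  rewrite lfunE /= tnth_mktuple -rowE; apply/rowP => i.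
  by rewrite !mxE eqxx eq_sym; case: eqP => _; rewrite ?mulr1 ?mulr0.
pose coact x := diag (fun j => (x == h j)%:R).
exists (YDData 'rV[k]_d coact (fun g => diag (lam g))).
exists X; split=> [|x j|g j]; rewrite ?diagX //; last first.
  by case: eqP => _; rewrite ?scale1r ?scale0r.
rewrite basisEfree subvf size_tuple dimvf [dim _]mul1n leqnn !andbT.
apply/freeP => c.
rewrite (eq_bigr (fun j => c j *: delta_mx 0 j)) => [|j _]; last first.
  by rewrite -tnth_nth tnth_mktuple.
move=> sum0 i; have /rowP/(_ i) := sum0; rewrite summxE mxE (bigD1 i) //= big1.
  by rewrite !mxE !eqxx mulr1 addr0.
by move=> j neq_ji; rewrite !mxE eq_sym (negPf neq_ji) andbF mulr0.
Qed.

End Diagonal.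

(** The common form of the lift of a module along a section of an epimorphism
    and of its descent along the epimorphism. *)
Definition regrade (k : fieldType) (H H1 : finGroupType) (f : H -> H1)
    (r : H1 -> H) (V : yd_data k H) : yd_data k H1 :=
  YDData V (fun y => \sum_(x | f x == y) yd_coact V x) (fun y => yd_act V (r y)).

Lemma pres_regrade (k : fieldType) (H H1 : finGroupType) (f : H -> H1)
    (r : H1 -> H) (V : yd_data k H) d (h : 'I_d -> H) (X : d.-tuple V) lam :
  diag_pres h X lam ->
  diag_pres (V := regrade f r V) (fun j => f (h j)) X (fun g j => lam (r g) j).
Proof.
case=> basX coX actX; split=> //= y j; rewrite sum_lfunE.
under eq_bigr do rewrite coX.
rewrite -big_mkcondr /= (eq_bigl (fun x => (x == h j) && (f (h j) == y))).
  by rewrite eq_sym big_mkcondr big_pred1_eq; case: eqP.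
by move=> x /=; rewrite andbC; case: eqP => // ->.
Qed.

(** * Products of cyclic groups in exponents *)

Section CyclicExponents.
Variables (n : nat) (M : 'I_n -> nat).
Hypothesis M_gt0 : forall i, (0 < M i)%N.
Implicit Types x y : cyc n M.

Lemma cyc_ltn x i : (x i < M i)%N.
Proof. by apply: leq_trans (ltn_ord _) _; rewrite prednK. Qed.

Lemma cyc_ext x y : (forall i, x i = y i :> nat) -> x = y.
Proof. by move=> eq_xy; apply/ffunP => i; apply/val_inj/eq_xy. Qed.

Lemma cycM x y i : (x * y)%g i = ((x i + y i) %% M i)%N :> nat.
Proof. by rewrite ffunE; congr (_ %% _)%N; rewrite prednK. Qed.

Lemma cyc1 i : (1%g : cyc n M) i = 0 :> nat.
Proof. by rewrite ffunE. Qed.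

Lemma cycX x m i : (x ^+ m)%g i = ((m * x i) %% M i)%N :> nat.
Proof.
elim: m => [|m IHm]; first by rewrite expg0 cyc1 mul0n mod0n.
by rewrite expgS cycM IHm modnDmr mulSn.
Qed.

Lemma of_expsE s i : of_exps M s i = (s i %% M i)%N :> nat.
Proof. by rewrite ffunE /= prednK. Qed.

Lemma cycC x y : (x * y = y * x)%g.
Proof. by apply: cyc_ext => i; rewrite !cycM addnC. Qed.

Lemma cyc_abelian (A : {set cyc n M}) : abelian A.
Proof. by apply/centsP => x _ y _; apply: cycC. Qed.

Lemma cyc_prod I (r : seq I) (P : pred I) (F : I -> cyc n M) i :
  ((\prod_(j <- r | P j) F j)%g i = \sum_(j <- r | P j) F j i %[mod M i])%N.
Proof.
apply: (big_rec2 (fun (x : cyc n M) (m : nat) => x i = m %[mod M i])%N).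
  by rewrite cyc1.
by move=> j x m _ IH; rewrite cycM modn_mod -modnDmr IH modnDmr.
Qed.

Lemma cyc_prod_gen x : x = (\prod_i gen M i ^+ x i)%g.
Proof.
apply: cyc_ext => i; rewrite -[LHS](modn_small (cyc_ltn x i)).
rewrite -[RHS](modn_small (cyc_ltn _ i)) cyc_prod (bigD1 i) //= big1 => [|j neq_ji].
  by rewrite cycX of_expsE eqxx addn0 modn_mod modnMmr muln1.
by rewrite cycX of_expsE eq_sym (negPf neq_ji) mod0n muln0 mod0n.
Qed.

Lemma cyc_char_gen (k : fieldType) (mu : cyc n M -> k) :
  mu 1%g = 1 -> (forall x y, mu (x * y)%g = mu x * mu y) ->
  forall x, mu x = \prod_i mu (gen M i) ^+ x i.
Proof.
move=> mu1 muM x; rewrite {1}[x]cyc_prod_gen (big_morph mu muM mu1).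
apply: eq_bigr => i _; elim: (x i : nat) => [|m IHm]; first by rewrite expg0 mu1.
by rewrite expgS exprS muM IHm.
Qed.

End CyclicExponents.

(** * The cocycles and cochains as values of characters *)

Section Roots.
Variables (k : fieldType) (zeta : nat -> k).
Hypothesis zetaP : compatible_roots zeta.

Lemma zeta_eq t i j : (0 < t)%N ->
  (zeta t ^+ i == zeta t ^+ j) = (i == j %[mod t])%N.
Proof. by move=> /(proj1 zetaP)/eq_prim_root_expr. Qed.

Lemma zeta_mod t i j : (0 < t)%N -> (i = j %[mod t])%N -> zeta t ^+ i = zeta t ^+ j.
Proof. by move=> t_gt0 /eqP; rewrite -zeta_eq // => /eqP. Qed.

Lemma zeta_expM s t i : (0 < s)%N -> (0 < t)%N ->
  zeta (s * t)%N ^+ (s * i) = zeta t ^+ i.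
Proof. by move=> s_gt0 t_gt0; rewrite exprM (proj2 zetaP). Qed.

Lemma zeta_neq0 t : (0 < t)%N -> zeta t != 0.
Proof.
move=> t_gt0; apply: contraTneq (oner_neq0 k) => zt0.
by rewrite -(prim_expr_order (proj1 zetaP _ t_gt0)) zt0 expr0n gtn_eqF // eqxx.
Qed.

Lemma zeta_expz t (i : int) : (0 < t)%N -> zeta t ^ i = zeta t ^+ `|(i %% t)%Z|.
Proof.
move=> t_gt0; have ut : zeta t \is a GRing.unit by rewrite unitfE zeta_neq0.
rewrite {1}(divz_eq i t) exprzDr // [(i %/ t)%Z * _]mulrC -exprz_exp -exprnP.
have -> : zeta t ^+ t = 1 by apply: prim_expr_order; apply: (proj1 zetaP).
rewrite exp1rz mul1r -{1}[(i %% t)%Z]gez0_abs // modz_ge0 //.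
by rewrite -lt0n.
Qed.

Lemma zeta_eqz t (i j : int) : (0 < t)%N ->
  (zeta t ^ i == zeta t ^ j) = (i == j %[mod t])%Z.
Proof.
move=> t_gt0; have t_neq0 : t%:Z != 0 by rewrite -lt0n.
have i_small l : (`|(l %% t)%Z| < t)%N.
  by rewrite -ltz_nat gez0_abs ?modz_ge0 // ltz_pmod.
rewrite !zeta_expz // zeta_eq // !modn_small //.
by rewrite -eqz_nat !gez0_abs ?modz_ge0.
Qed.

End Roots.

Section CocycleCharacters.
Variables (k : fieldType) (zeta : nat -> k).
Hypothesis zetaP : compatible_roots zeta.
Variables (n : nat) (mm : 'I_n -> nat).
Hypothesis mm_gt0 : forall i, (0 < mm i)%N.
Variable a : cocycle_seq n.
Implicit Types (s t : 'I_n) (x y : 'I_n -> nat).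

Lemma sqm_gt0 i : (0 < sqm mm i)%N.
Proof. by rewrite expn_gt0 mm_gt0. Qed.

Definition beta_exp s t : nat :=
  if s == t then a1 a s else if (s < t)%N then a2 a s t else 0.

(** The characters of the group that pair with the carries in each cyclic
    factor: both the cocycle and the cochain are products of their values. *)
Definition beta s x : k := \prod_t zeta (mm t) ^+ (beta_exp s t * x t).

Lemma betaE s x : beta s x =
  zeta (mm s) ^+ (a1 a s * x s)
  * \prod_(t : 'I_n | (s < t)%N) zeta (mm t) ^+ (a2 a s t * x t).
Proof.
rewrite /beta (bigD1 s) //= /beta_exp eqxx; congr (_ * _).
rewrite big_mkcond [RHS]big_mkcond; apply: eq_bigr => t _.
by rewrite -[s == t]val_eqE -[t == s]val_eqE /=; case: ltngtP.
Qed.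

Lemma beta_neq0 s x : beta s x != 0.
Proof. by apply/prodf_neq0 => t _; rewrite expf_neq0 ?(zeta_neq0 zetaP). Qed.

Lemma beta_mod s x y : (forall t, x t = y t %[mod mm t])%N -> beta s x = beta s y.
Proof.
move=> eq_xy; apply: eq_bigr => t _; apply: (zeta_mod zetaP) => //.
by rewrite -modnMmr eq_xy modnMmr.
Qed.

Lemma betaD s x y : beta s (fun t => x t + y t)%N = beta s x * beta s y.
Proof.
by rewrite -big_split; apply: eq_bigr => t _; rewrite mulnDr exprD.
Qed.

Lemma betaM s (g h : cyc n mm) :
  beta s (fun t => (g * h)%g t) = beta s (fun t => g t) * beta s (fun t => h t).
Proof.
by rewrite -betaD; apply: beta_mod => t; rewrite cycM // modn_mod.
Qed.

Lemma pi_funE (g : cyc n (sqm mm)) t : pi_fun g t = (g t %% mm t)%N :> nat.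
Proof. by rewrite of_expsE. Qed.

Lemma iota_secE (g : cyc n mm) t : iota_sec g t = g t :> nat.
Proof.
rewrite of_expsE; last exact: sqm_gt0.
apply: modn_small; apply: leq_trans (cyc_ltn mm_gt0 g t) _.
by rewrite /sqm expnS expn1 leq_pmulr.
Qed.

Lemma iota_secK : cancel (@iota_sec n mm) (@pi_fun n mm).
Proof.
move=> g; apply: cyc_ext => t; rewrite pi_funE iota_secE modn_small //.
exact: cyc_ltn.
Qed.

Lemma pi_mulg (g h : cyc n (sqm mm)) :
  pi_fun (g * h)%g = (pi_fun g * pi_fun h)%g.
Proof. by rewrite pi_funM ?inE. Qed.

Lemma pi_1 : pi_fun (1%g : cyc n (sqm mm)) = 1%g.
Proof. by apply: cyc_ext => t; rewrite pi_funE !cyc1 mod0n. Qed.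

Lemma beta_pi s (g : cyc n (sqm mm)) :
  beta s (fun t => pi_fun g t) = beta s (fun t => g t).
Proof. by apply: beta_mod => t; rewrite pi_funE modn_mod. Qed.

Lemma J_betaE (g h : cyc n (sqm mm)) :
  J_a zeta a g h = \prod_s beta s (fun t => g t) ^+ (h s %/ mm s).
Proof.
under [RHS]eq_bigr do rewrite betaE exprMn.
rewrite big_split; congr (_ * _); apply: eq_bigr => s _.
  rewrite -exprM {1}(divn_eq (h s) (mm s)) addnK [(_ * mm s)%N]mulnC mulnCA.
  by rewrite -mulnA -(zeta_expM zetaP _ (mm_gt0 s) (mm_gt0 s)) mulnn.
rewrite -prodrXl; apply: eq_bigr => t _.
rewrite -exprM {1}(divn_eq (h s) (mm s)) addnK [(_ * mm s)%N]mulnC mulnCA.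
by rewrite zeta_expM.
Qed.

Lemma J_neq0 g h : J_a zeta (mm := mm) a g h != 0.
Proof.
by rewrite J_betaE; apply/prodf_neq0 => s _; rewrite expf_neq0 ?beta_neq0.
Qed.

Lemma J_mull e f h :
  J_a zeta (mm := mm) a (e * f)%g h = J_a zeta a e h * J_a zeta a f h.
Proof.
rewrite !J_betaE -big_split; apply: eq_bigr => s _ /=.
by rewrite -exprMn -beta_pi pi_mulg betaM !beta_pi.
Qed.

Lemma J_pil e f h : pi_fun e = pi_fun f ->
  J_a zeta (mm := mm) a e h = J_a zeta a f h.
Proof.
move=> eq_ef; rewrite !J_betaE; apply: eq_bigr => s _.
by rewrite -beta_pi eq_ef beta_pi.
Qed.

Lemma J_section e (x : cyc n mm) : J_a zeta a e (iota_sec x) = 1.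
Proof.
rewrite J_betaE big1 // => s _.
by rewrite iota_secE divn_small ?expr0 // cyc_ltn.
Qed.

Lemma J_onel h : J_a zeta (mm := mm) a 1%g h = 1.
Proof.
by apply: (mulfI (J_neq0 1%g h)); rewrite -J_mull mulg1 mulr1.
Qed.

Lemma J_oner h : J_a zeta (mm := mm) a h 1%g = 1.
Proof. by rewrite J_betaE big1 // => s _; rewrite cyc1 div0n expr0. Qed.

Hypothesis a3_eq0 :
  forall r s t : 'I_n, (r < s)%N -> (s < t)%N -> a3 a r s t = 0%N.

Lemma Phi_betaE (g e f : cyc n mm) :
  Phi_a zeta a g e f = \prod_s beta s (fun t => g t) ^+ ((e s + f s) %/ mm s).
Proof.
rewrite /Phi_a [X in _ * X]big1 => [|r _]; last first.
  rewrite big1 // => s lt_rs; rewrite big1 // => t lt_st.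
  by rewrite a3_eq0 // invr1.
under [RHS]eq_bigr do rewrite betaE exprMn.
rewrite mulr1 big_split; congr (_ * _); apply: eq_bigr => s _.
  by rewrite -exprM.
by rewrite -prodrXl; apply: eq_bigr => t _; rewrite -exprM.
Qed.

Lemma Phi_neq0 (g e f : cyc n mm) : Phi_a zeta a g e f != 0.
Proof.
by rewrite Phi_betaE; apply/prodf_neq0 => s _; rewrite expf_neq0 ?beta_neq0.
Qed.

Lemma tilde_Phi (g e f : cyc n mm) :
  tilde (Phi_a zeta a) g e f = Phi_a zeta a g e f.
Proof.
have PhiC : Phi_a zeta a e f g = Phi_a zeta a e g f.
  by rewrite !Phi_betaE; apply: eq_bigr => s _; rewrite addnC.
by rewrite /tilde PhiC mulfK ?Phi_neq0.
Qed.

Lemma tilde_pi_Phi (g e f : cyc n (sqm mm)) :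
  tilde (pi_Phi zeta a) g e f = Phi_a zeta a (pi_fun g) (pi_fun e) (pi_fun f).
Proof. exact: tilde_Phi. Qed.

(** The carry of e s + f s modulo mm s is the defect of additivity of the quotient
    by mm s. Reducing e s + f s modulo the square of mm s changes the quotient by a
    multiple of mm s; this is harmless under the torsion hypothesis, which is not
    automatic: for t > s the values of beta s at g t are powers of zeta (mm t). *)
Lemma J_mulr (h e f : cyc n (sqm mm)) :
  (forall s, beta s (fun t => h t) ^+ mm s = 1) ->
  J_a zeta a h (e * f)%g =
  J_a zeta a h e * J_a zeta a h f
  * Phi_a zeta a (pi_fun h) (pi_fun e) (pi_fun f).
Proof.
move=> beta_tors; rewrite !J_betaE Phi_betaE -!big_split; apply: eq_bigr => s _ /=.
rewrite beta_pi !pi_funE -!exprD cycM; last exact: sqm_gt0.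
set e_ := (e s : nat); set f_ := (f s : nat).
have -> : (e_ %/ mm s + f_ %/ mm s + (e_ %% mm s + f_ %% mm s) %/ mm s
           = (e_ + f_) %/ mm s)%N.
  rewrite {3}(divn_eq e_ (mm s)) {3}(divn_eq f_ (mm s)) addnACA -mulnDl.
  by rewrite divnMDl.
have -> : ((e_ + f_) %/ mm s = (e_ + f_) %/ sqm mm s * mm s
                               + (e_ + f_) %% sqm mm s %/ mm s)%N.
  by rewrite {1}(divn_eq (e_ + f_) (sqm mm s)) {2}/sqm -mulnn mulnA divnMDl.
by rewrite exprD [(_ * mm s)%N]mulnC exprM beta_tors expr1n mul1r.
Qed.

End CocycleCharacters.

(** * Lifting generators *)

Section Generation.
Variables (n : nat) (mm : 'I_n -> nat).
Hypothesis mm_gt0 : forall i, (0 < mm i)%N.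

(** The kernel of pi lies in every maximal subgroup M. Indeed M has prime index p,
    hence contains all p-th powers; the generator g ^ mm i of the kernel is one if p
    divides mm i, and otherwise so is g itself, its order being prime to p. *)
Lemma lift_generates (K : {group cyc n (sqm mm)}) :
  (forall y : cyc n mm, exists2 x, x \in K & pi_fun x = y) -> K :=: [set: _].
Proof.
move=> piK; apply/eqP; rewrite eqEsubset subsetT /=; apply: contraT => nsTK.
pose G := [set: cyc n (sqm mm)]%G.
have abG : abelian G := cyc_abelian (sqm_gt0 mm_gt0) _.
pose proper_normal (M : {set cyc n (sqm mm)}) := (M \proper G) && (G \subset 'N(M)%g).
have [|M maxM sKM] := @maxgroup_exists _ proper_normal K.
  by rewrite /proper_normal properE subsetT /= nsTK /= sub_abelian_norm.
have p_pr := index_maxnormal_sol_prime (abelian_sol abG) maxM.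
have /andP[/andP[_ nsTM] nMG] := maxgroupp maxM.
set p := #|G : M|%g in p_pr.
have Mexp x : (x ^+ p)%g \in M.
  have xN : x \in 'N(M)%g by rewrite (subsetP nMG) ?inE.
  apply: coset_idr; rewrite ?groupX // morphX //= /p -card_quotient //.
  by rewrite expg_cardG // mem_quotient ?inE.
have Mgen i : (gen (sqm mm) i ^+ mm i)%g \in M.
  set g := gen _ i; have [p_dvd|p_ndvd] := boolP (p %| mm i)%N.
    by rewrite -(divnK p_dvd) mulnC expgM groupX.
  have g_ord : (#[g]%g %| sqm mm i)%N.
    rewrite order_dvdn; apply/eqP/cyc_ext => j; rewrite cyc1 cycX; last exact: sqm_gt0.
    rewrite of_expsE; last exact: sqm_gt0.
    by case: eqP => [->|_]; rewrite ?mod0n ?muln0 ?mod0n // modnMr.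
  have co_gp : coprime #[g]%g p.
    rewrite coprime_sym prime_coprime // (contra _ p_ndvd) //.
    by move=> /dvdn_trans/(_ g_ord); rewrite Euclid_dvdX // => /andP[].
  have : g \in <[g ^+ p]>%g.
    suff /eqP <- : generator <[g]> (g ^+ p)%g by rewrite cycle_id.
    by rewrite generator_coprime.
  by case/cycleP=> m ->; do 2!apply: groupX; apply: Mexp.
case/negP: nsTM; apply/subsetP => z _.
have [x Kx pi_x] := piK (pi_fun z).
rewrite -(mulKVg x z) groupM ?(subsetP sKM x Kx) //.
set w := (x^-1 * z)%g.
have dvd_w i : (mm i %| w i)%N.
  have pi_w : pi_fun w = 1%g.
    by rewrite pi_mulg // -pi_x -pi_mulg // mulVg pi_1.
  by rewrite /dvdn -pi_funE // pi_w cyc1.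
rewrite (cyc_prod_gen (sqm_gt0 mm_gt0) w) group_prod // => i _.
by rewrite -(divnK (dvd_w i)) mulnC expgM groupX.
Qed.

End Generation.

Lemma eqz_mod_sum (I : Type) (r : seq I) (P : pred I) (F E : I -> int) (m : int) :
  (forall i, P i -> F i = E i %[mod m])%Z ->
  (\sum_(i <- r | P i) F i = \sum_(i <- r | P i) E i %[mod m])%Z.
Proof.
move=> eqFE; apply: (big_rec2 (fun x y => x = y %[mod m])%Z) => // i x y Pi IH.
by rewrite -modzDm eqFE // IH modzDm.
Qed.

Lemma modz_mod_dvd (m d e : int) : (d %| e)%Z -> ((m %% e)%Z = m %[mod d])%Z.
Proof.
by case/dvdzP=> q ->; rewrite [in RHS](divz_eq m (q * d)) mulrA modzMDl.
Qed.

Section Exponents.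
Variables (n : nat) (M : 'I_n -> nat) (d : nat) (S : 'M[nat]_(d, n)).
Hypothesis M_gt0 : forall i, (0 < M i)%N.
Let h j : cyc n M := of_exps M (S j).

Lemma generated_exps (x : cyc n M) : x \in <<[set h j | j : 'I_d]>>%g ->
  exists T : 'I_d -> int, forall l,
    (\sum_j T j * (S j l)%:Z = (x l : nat)%:Z %[mod (M l)%:Z])%Z.
Proof.
case/gen_prodgP => m [c cP ->] {x}.
elim/big_ind: _ => [|x y [Tx TxE] [Ty TyE]|i _].
- by exists (fun=> 0) => l; rewrite cyc1 big1 // => j _; rewrite mul0r.
- exists (fun j => Tx j + Ty j) => l; rewrite cycM // -modz_nat modz_mod PoszD.
  by under eq_bigr do rewrite mulrDl; rewrite big_split /= -[LHS]modzDm TxE TyE modzDm.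
- have /imsetP[j _ ->] := cP i; exists (fun j' => (j' == j)%:Z) => l.
  rewrite (bigD1 j) //= eqxx mul1r big1 ?addr0 => [|j' /negPf->]; last by rewrite mul0r.
  by rewrite of_expsE // -modz_nat modz_mod.
Qed.

Lemma exps_generate (T : 'M[int]_(n, d)) :
  (forall j l, (\sum_i T j i * (S i l)%:Z == (j == l)%:Z %[mod (M l)%:Z])%Z) ->
  <<[set h j | j : 'I_d]>>%g = [set: cyc n M].
Proof.
move=> TS; apply/eqP; rewrite eqEsubset subsetT /=; apply/subsetP => x _.
rewrite (cyc_prod_gen M_gt0 x) group_prod // => i _; rewrite groupX //.
(* integer exponents become natural ones modulo a common multiple of the M l *)
pose N := \prod_l M l.
have N_gt0 : (0 < N)%N by rewrite prodn_gt0.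
pose c j := `|(T i j %% N)%Z|%N.
have -> : gen M i = (\prod_j h j ^+ c j)%g.
  apply: cyc_ext => l; rewrite -[LHS](modn_small (cyc_ltn M_gt0 _ _)).
  rewrite -[RHS](modn_small (cyc_ltn M_gt0 _ _)) cyc_prod //.
  apply/eqP; rewrite -eqz_nat -!modz_nat of_expsE // -modz_nat modz_mod eq_sym.
  have /eqP := TS i l; rewrite [l == i]eq_sym => <-.
  have dvdMN : (M l %| N)%N by rewrite /N (bigD1 l) //= dvdn_mulr.
  rewrite (big_morph Posz PoszD (erefl _)); apply/eqP/eqz_mod_sum => j _.
  rewrite cycX // of_expsE // modnMmr -modz_nat modz_mod PoszM -modzMml.
  rewrite /c gez0_abs ?modz_ge0 -?lt0n //.
  by rewrite modz_mod_dvd // modzMml.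
by rewrite group_prod // => j _; rewrite groupX // mem_gen // imset_f.
Qed.

End Exponents.

(** * The associated sequence in terms of the characters beta *)

Lemma expfz_sum (F : fieldType) (x : F) I (r : seq I) (P : pred I) (e : I -> int) :
  x != 0 -> x ^ (\sum_(i <- r | P i) e i) = \prod_(i <- r | P i) x ^ e i.
Proof.
by move=> x_neq0; apply: (big_morph (exprz x)) => // i j; rewrite expfzDr.
Qed.

Lemma eqz_mod_trans_dvd (m d i j : int) : (d %| m)%Z ->
  (i = j %[mod m])%Z -> (i = j %[mod d])%Z.
Proof.
move=> dvd_dm /eqP; rewrite eqz_mod_dvd => /(dvdz_trans dvd_dm).
by rewrite -eqz_mod_dvd => /eqP.
Qed.

Lemma expfz_prod (F : fieldType) (z : int) I (r : seq I) (P : pred I) (x : I -> F) :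
  (\prod_(i <- r | P i) x i) ^ z = \prod_(i <- r | P i) x i ^ z.
Proof.
apply: (big_morph (fun y => y ^ z)) => [y t|]; first exact: expfzMl.
exact: exp1rz.
Qed.

Section AssociatedSequence.
Variables (k : fieldType) (zeta : nat -> k).
Hypothesis zetaP : compatible_roots zeta.
Variables (n : nat) (mm : 'I_n -> nat).
Hypothesis mm_gt0 : forall i, (0 < mm i)%N.
Hypothesis mm_dvd : forall i j : 'I_n, (i < j)%N -> (mm i %| mm j)%N.
Variable a : cocycle_seq n.
Implicit Types i l t : 'I_n.

Let zeta_mm_neq0 i : zeta (mm i) != 0. Proof. exact: (zeta_neq0 zetaP). Qed.

(** According to the order of i and l, the statement that zeta (mm i) ^ x is the
    value of beta i at g l is one of the three congruences on x = \sum_j x_ij t_lj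
    in the definitions of root data and of associated sequences. *)
Lemma beta_exp_diag i (x : int) :
  (zeta (mm i) ^ x == zeta (mm i) ^+ beta_exp a i i)
  = ((a1 a i)%:Z == x %[mod (mm i)%:Z])%Z.
Proof. by rewrite exprnP (zeta_eqz zetaP) // /beta_exp eqxx eq_sym. Qed.

Lemma beta_exp_lt i l (x : int) : (l < i)%N ->
  (zeta (mm i) ^ x == zeta (mm l) ^+ beta_exp a i l) = (x == 0 %[mod (mm i)%:Z])%Z.
Proof.
move=> lt_li; rewrite /beta_exp -val_eqE /= gtn_eqF // ltnNge ltnW //= expr0.
by rewrite -[1](expr0z (zeta (mm i))) (zeta_eqz zetaP).
Qed.

Lemma beta_exp_gt i l (x : int) : (i < l)%N ->
  (zeta (mm i) ^ x == zeta (mm l) ^+ beta_exp a i l)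
  = ((a2 a i l)%:Z == (mm l %/ mm i)%N%:Z * x %[mod (mm l)%:Z])%Z.
Proof.
move=> lt_il; rewrite /beta_exp -val_eqE /= ltn_eqF // lt_il.
have c_gt0 : (0 < mm l %/ mm i)%N by rewrite divn_gt0 // dvdn_leq // mm_dvd.
have zetaE : zeta (mm l) ^+ (mm l %/ mm i) = zeta (mm i).
  by rewrite -{1}(divnK (mm_dvd lt_il)) (proj2 zetaP).
by rewrite [RHS]eq_sym -(zeta_eqz zetaP) // -exprz_exp -!exprnP zetaE.
Qed.

Section Values.
Variables (d : nat) (S : 'M[nat]_(d, n)) (X : 'M[nat]_(n, d)).

(** Both sides are the value of beta i at g l, on the left computed from its
    values at the h j through g l = \prod_j h j ^ T l j. *)
Lemma beta_exp_of_T (T : 'M[int]_(n, d)) :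
  (forall i j, zeta (mm i) ^+ X i j = beta zeta mm a i (S j)) ->
  (forall j l, (\sum_i T j i * (S i l)%:Z == (j == l)%:Z %[mod (sqm mm l)%:Z])%Z) ->
  forall i l, zeta (mm i) ^ (\sum_j (X i j)%:Z * T l j)
              = zeta (mm l) ^+ beta_exp a i l.
Proof.
move=> X_beta TS i l; rewrite expfz_sum //.
under eq_bigr => j _ do rewrite -exprz_exp -exprnP X_beta /beta expfz_prod.
rewrite exchange_big /=.
transitivity (\prod_t zeta (mm t) ^ ((beta_exp a i t)%:Z * (l == t)%:Z)).
  apply: eq_bigr => t _.
  under eq_bigr => j _ do rewrite exprnP exprz_exp PoszM -mulrA [_ * T l j]mulrC.
  rewrite -expfz_sum // -mulr_sumr -!exprz_exp.
  apply/eqP; rewrite !exprz_exp (zeta_eqz zetaP) // -modzMmr -[in X in _ == X]modzMmr.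
  apply/eqP; congr (_ %% _)%Z; congr (_ * _).
  apply: eqz_mod_trans_dvd (eqP (TS l t)).
  by apply/dvdzP; exists (mm t)%:Z; rewrite -PoszM mulnn.
rewrite (bigD1 l) //= eqxx mulr1 -exprnP big1 ?mulr1 // => t neq_tl.
by rewrite eq_sym (negPf neq_tl) mulr0 expr0z.
Qed.

(** Two solutions of T *m S = 1 differ by rows N with N *m S = 0. Adding N to the
    last row of T, where the second condition on T is void, keeps T admissible
    and must leave the associated sequence unchanged. *)
Lemma X_kernel (T : 'M[int]_(n, d)) (N : 'I_d -> int) :
  admissible mm S X T ->
  (forall T', admissible mm S X T' -> forall i l,
     zeta (mm i) ^ (\sum_j (X i j)%:Z * T' l j) = zeta (mm l) ^+ beta_exp a i l) ->
  (forall l, (\sum_j N j * (S j l)%:Z == 0 %[mod (sqm mm l)%:Z])%Z) ->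
  forall i, zeta (mm i) ^ (\sum_j (X i j)%:Z * N j) = 1.
Proof.
move=> admT seqT NS i.
have n_gt0 : (0 < n)%N by apply: leq_ltn_trans (ltn_ord i).
have last_lt : (n.-1 < n)%N by rewrite prednK.
pose last := Ordinal last_lt.
pose T' := \matrix_(l, j) (T l j + (l == last)%:Z * N j).
have sumT' l (F : 'I_d -> int) :
    \sum_j F j * T' l j = \sum_j F j * T l j + (l == last)%:Z * \sum_j F j * N j.
  rewrite mulr_sumr -big_split; apply: eq_bigr => j _ /=.
  by rewrite !mxE mulrDr [F j * (_ * _)]mulrCA.
have [TS TX] := admT.
have admT' : admissible mm S X T'.
  split=> [l t|l i' lt_li'].
    under eq_bigr do rewrite mulrC.
    rewrite sumT'; under eq_bigr do rewrite mulrC.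
    rewrite -modzDm (eqP (TS l t)) -modzMmr.
    under [\sum_j _ * N j]eq_bigr do rewrite mulrC.
    by rewrite (eqP (NS t)) modzMmr mulr0 modzDm addr0.
  rewrite sumT' [l == last](introF eqP _) ?mul0r ?addr0 ?TX // => eq_l.
  by have := leq_ltn_trans lt_li' (ltn_ord i'); rewrite eq_l /= prednK // ltnn.
have := seqT T' admT' i last; rewrite -(seqT T admT i last) sumT' eqxx mul1r.
rewrite expfzDr // => /(canRL (mulKf _)) -> //; first by rewrite mulVf ?expfz_neq0.
by rewrite expfz_neq0.
Qed.

(** For N = e_j - S_j *m T, where e_j and S_j are the j-th rows of the identity and
    of S, one has N *m S = 0; the relation X_kernel for this N expresses x_ij by the
    \sum_j' x_ij' t_lj', that is by the values of beta i at the g l. *)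
Lemma X_beta_of_T (T : 'M[int]_(n, d)) :
  admissible mm S X T ->
  (forall T', admissible mm S X T' -> forall i l,
     zeta (mm i) ^ (\sum_j (X i j)%:Z * T' l j) = zeta (mm l) ^+ beta_exp a i l) ->
  forall i j, zeta (mm i) ^+ X i j = beta zeta mm a i (S j).
Proof.
move=> admT seqT i j.
pose N j' : int := (j == j')%:Z - \sum_l (S j l)%:Z * T l j'.
have sumN (F : 'I_d -> int) : \sum_j' F j' * N j'
    = F j - \sum_l (S j l)%:Z * \sum_j' F j' * T l j'.
  under eq_bigr do rewrite mulrBr.
  rewrite sumrB; congr (_ - _).
    rewrite (bigD1 j) //= eqxx mulr1 big1 ?addr0 // => j' neq_j'.
    by rewrite eq_sym (negPf neq_j') mulr0.
  under eq_bigr do rewrite mulr_sumr.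
  rewrite exchange_big; apply: eq_bigr => l _ /=; rewrite mulr_sumr.
  by apply: eq_bigr => j' _; rewrite mulrCA.
have NS l : (\sum_j' N j' * (S j' l)%:Z == 0 %[mod (sqm mm l)%:Z])%Z.
  under eq_bigr do rewrite mulrC.
  rewrite sumN eqz_mod_dvd subr0 -eqz_mod_dvd.
  rewrite [in X in _ == X](@eqz_mod_sum _ _ _ _ (fun t => (S j t)%:Z * (t == l)%:Z)).
    rewrite (bigD1 l) //= eqxx mulr1 big1 ?addr0 // => t neq_tl.
    by rewrite (negPf neq_tl) mulr0.
  move=> t _; under eq_bigr do rewrite mulrC.
  by rewrite -modzMmr (eqP (proj1 admT t l)) modzMmr.
have := X_kernel admT seqT NS i; rewrite sumN expfzDr // -invr_expz.
move/(canRL (mulfVK _)); rewrite mul1r -exprnP => ->; last exact: expfz_neq0.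
rewrite expfz_sum //; apply: eq_bigr => l _.
by rewrite mulrC -exprz_exp (seqT T) // -exprnP -exprM.
Qed.

End Values.
End AssociatedSequence.

(** * Twisting and descent *)

Section Untwisting.
Variables (k : fieldType) (zeta : nat -> k).
Hypothesis zetaP : compatible_roots zeta.
Variables (n : nat) (mm : 'I_n -> nat).
Hypothesis mm_gt0 : forall i, (0 < mm i)%N.
Variable a : cocycle_seq n.

Lemma tilde_trivial (H : finGroupType) (g e f : H) :
  tilde (@trivial_cocycle k H) g e f = 1.
Proof. by rewrite /tilde /trivial_cocycle !mul1r invr1. Qed.

Lemma pres_lift (V : yd_data k (cyc n mm)) d (h : 'I_d -> cyc n mm)
    (X : d.-tuple V) lam :
  diag_pres h X lam ->
  diag_pres (V := lift_yd V) (fun j => iota_sec (h j)) X (fun g j => lam (pi_fun g) j).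
Proof. exact: pres_regrade. Qed.

(** The degrees of the lifted module are in the image of the section, where the
    right argument of the cochain is trivial. *)
Lemma pres_untwist (V : yd_data k (cyc n mm)) d (h : 'I_d -> cyc n mm)
    (X : d.-tuple V) lam :
  diag_pres h X lam ->
  diag_pres (V := untwist zeta a V) (fun j => iota_sec (h j)) X
    (fun g j => J_a zeta a (iota_sec (h j)) g * lam (pi_fun g) j).
Proof.
move=> /pres_lift presL.
have := pres_twist presL (fun x y => (J_a zeta a x y)^-1).
by apply: pres_ext => // g j; rewrite J_section // invr1 mul1r invrK.
Qed.

(** The coaction of the untwisted module is concentrated on the image of the
    section, and the untwisting rescales the action on homogeneous vectors. *)
Lemma canonical_of_untwist (V : yd_data k (cyc n mm)) d
    (h : 'I_d -> cyc n (sqm mm)) (X : d.-tuple (untwist zeta a V)) :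
  is_YD trivial_cocycle (untwist zeta a V) -> canonical_basis h X ->
  (forall j, iota_sec (pi_fun (h j)) = h j) /\
  canonical_basis (V := V) (fun j => pi_fun (h j)) X.
Proof.
move=> ydU canX; have presU := canonical_pres ydU canX.
case: canX => basX degX actX.
have coactE y v : yd_coact (untwist zeta a V) (iota_sec y) v = yd_coact V y v.
  rewrite /= (big_pred1 y) // => x.
  by rewrite /= (can_eq (iota_secK mm_gt0)).
have hK j : iota_sec (pi_fun (h j)) = h j.
  apply/eqP; apply: contraT => notin_iota.
  have := basis_tnth_neq0 j basX; rewrite -(degX j) /= big_pred0 ?lfunE ?eqxx //.
  move=> x /=; apply: contraNF notin_iota => /eqP <-.
  by rewrite iota_secK.
split=> //; split=> // [j|g j]; first by rewrite -coactE hK degX.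
have := actX (iota_sec g) j.
rewrite (@twist_act _ _ _ _ (h j)) => [|y]; last exact: (pres_coact presU).
rewrite rpredZeq mulf_eq0 !invr_eq0 !(negPf (J_neq0 zetaP mm_gt0 a _ _)) /=.
by rewrite iota_secK.
Qed.

Hypothesis a3_eq0 :
  forall r s t : 'I_n, (r < s)%N -> (s < t)%N -> a3 a r s t = 0%N.

(** By J_mulr the factor J_a (h j) absorbs the cocycle in the projective action. *)
Lemma untwist_YD (V : yd_data k (cyc n mm)) d (h : 'I_d -> cyc n mm)
    (X : d.-tuple V) lam :
  is_YD (Phi_a zeta a) V -> diag_pres h X lam ->
  (forall s j, beta zeta mm a s (fun t => h j t) ^+ mm s = 1) ->
  is_YD trivial_cocycle (untwist zeta a V).
Proof.
move=> ydV presV beta_tors; have [lam1 lamM] := YD_pres presV ydV.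
apply: (pres_YD (pres_untwist presV)) => [j|e f j].
  by rewrite pi_1 // lam1 J_oner ?mulr1.
rewrite tilde_trivial mul1r (J_mulr zetaP mm_gt0 a3_eq0); last first.
  by move=> s; rewrite -beta_pi // iota_secK.
rewrite mulrACA lamM tilde_Phi // pi_mulg iota_secK //.
by rewrite !mulrA.
Qed.

End Untwisting.

Section TwistedCharacters.
Variables (k : fieldType) (zeta : nat -> k).
Hypothesis zetaP : compatible_roots zeta.
Variables (n : nat) (mm : 'I_n -> nat).
Hypothesis mm_gt0 : forall i, (0 < mm i)%N.
Variable a : cocycle_seq n.
Hypothesis a3_eq0 :
  forall r s t : 'I_n, (r < s)%N -> (s < t)%N -> a3 a r s t = 0%N.
Variables (d : nat) (S : 'M[nat]_(d, n)) (X : 'M[nat]_(n, d)).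
Hypothesis X_beta : forall i j, zeta (mm i) ^+ X i j = beta zeta mm a i (S j).

Let h j : cyc n (sqm mm) := of_exps (sqm mm) (S j).

Definition root_char (g : cyc n (sqm mm)) (j : 'I_d) : k :=
  \prod_i zeta (sqm mm i) ^+ (X i j * g i).

(** The scalars of V_D: a character of the group for each j, deformed by the
    cochain. *)
Definition twisted_char (g : cyc n (sqm mm)) (j : 'I_d) : k :=
  root_char g j * (J_a zeta a g (h j) / J_a zeta a (h j) g).

Lemma root_charM e f j : root_char (e * f)%g j = root_char e j * root_char f j.
Proof.
rewrite -big_split; apply: eq_bigr => i _ /=.
rewrite -exprD -mulnDr cycM; last exact: sqm_gt0.
by apply: (zeta_mod zetaP); [exact: sqm_gt0 | rewrite modnMmr].
Qed.

Lemma root_char_of_exps (s : 'I_n -> nat) j :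
  root_char (of_exps (sqm mm) s) j = \prod_i zeta (sqm mm i) ^+ (s i * X i j).
Proof.
apply: eq_bigr => i _; rewrite of_expsE; last exact: sqm_gt0.
by apply: (zeta_mod zetaP); [exact: sqm_gt0 | rewrite modnMmr mulnC].
Qed.

Lemma root_char_gen i j : root_char (gen (sqm mm) i) j = zeta (sqm mm i) ^+ X i j.
Proof.
rewrite root_char_of_exps (bigD1 i) //= eqxx mul1n big1 ?mulr1 // => t /negPf->.
by rewrite mul0n.
Qed.

Lemma root_char1 j : root_char 1%g j = 1.
Proof. by rewrite /root_char big1 // => i _; rewrite cyc1 muln0. Qed.

Lemma root_char_neq0 g j : root_char g j != 0.
Proof.
apply/prodf_neq0 => i _; rewrite expf_neq0 // (zeta_neq0 zetaP) //.
exact: sqm_gt0.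
Qed.

Lemma twisted_char_neq0 g j : twisted_char g j != 0.
Proof.
rewrite mulf_neq0 ?root_char_neq0 // mulf_neq0 ?invr_neq0 //.
all: exact: (J_neq0 zetaP mm_gt0).
Qed.

Lemma beta_h s j : beta zeta mm a s (fun t => h j t) = beta zeta mm a s (S j).
Proof.
apply: (beta_mod zetaP mm_gt0) => t; rewrite of_expsE; last exact: sqm_gt0.
by rewrite modn_dvdm // dvdn_exp.
Qed.

Lemma beta_h_torsion s j : beta zeta mm a s (fun t => h j t) ^+ mm s = 1.
Proof.
rewrite beta_h -X_beta exprAC (prim_expr_order (proj1 zetaP _ (mm_gt0 s))).
exact: expr1n.
Qed.

Lemma twisted_char1 j : twisted_char 1%g j = 1.
Proof. by rewrite /twisted_char root_char1 J_onel // J_oner // divr1 mulr1. Qed.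

Lemma twisted_charM e f j : twisted_char e j * twisted_char f j
  = tilde (pi_Phi zeta a) (h j) e f * twisted_char (e * f)%g j.
Proof.
rewrite tilde_pi_Phi // /twisted_char root_charM J_mull //.
rewrite (J_mulr zetaP mm_gt0 a3_eq0 e f (fun s => beta_h_torsion s j)).
field; rewrite !J_neq0 // Phi_neq0 //.
Qed.

(** By X_beta, the contributions of the quotients g i %/ mm i to root_char g j and
    to J_a (h j) g are equal. *)
Lemma twisted_char_pi e f j :
  pi_fun e = pi_fun f -> twisted_char e j = twisted_char f j.
Proof.
suff charE g : twisted_char g j
    = \prod_i zeta (sqm mm i) ^+ (X i j * pi_fun g i) * J_a zeta a g (h j).
  by move=> eq_pi; rewrite !charE eq_pi (J_pil zetaP mm_gt0 a (h j) eq_pi).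
rewrite /twisted_char mulrA mulrAC; congr (_ * _).
apply: (canLR (mulfK (J_neq0 zetaP mm_gt0 a _ _))).
rewrite J_betaE // -big_split; apply: eq_bigr => i _ /=.
rewrite beta_h -X_beta pi_funE // -exprM.
rewrite -(zeta_expM zetaP (X i j * (g i %/ mm i)) (mm_gt0 i) (mm_gt0 i)) mulnn.
by rewrite -exprD mulnCA -mulnDr addnC [(mm i * _)%N]mulnC -divn_eq.
Qed.

(** Without the cochain factor the scalars of W form a character in each degree,
    which is determined by its values at the generators. *)
Lemma pres_twisted (W : yd_data k (cyc n (sqm mm))) (B : d.-tuple W) :
  is_YD (pi_Phi zeta a) W -> canonical_basis h B ->
  (forall i j, yd_act W (gen (sqm mm) i) (tnth B j)
     = (zeta (sqm mm i) ^+ X i j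
         * (J_a zeta a (gen (sqm mm) i) (h j)
            / J_a zeta a (h j) (gen (sqm mm) i))) *: tnth B j) ->
  diag_pres h B twisted_char.
Proof.
move=> ydW canB genB.
have [lam presW] : exists lam, diag_pres h B lam.
  by eexists; apply: canonical_pres ydW canB.
have [lam1 lamM] := YD_pres presW ydW.
apply: (pres_ext _ _ presW) => // g j.
pose mu g := lam g j * (J_a zeta a (h j) g / J_a zeta a g (h j)).
have mu1 : mu 1%g = 1 by rewrite /mu lam1 J_onel // J_oner // divr1 mulr1.
have muM e f : mu (e * f)%g = mu e * mu f.
  rewrite /mu [RHS]mulrACA lamM tilde_pi_Phi // J_mull //.
  rewrite (J_mulr zetaP mm_gt0 a3_eq0 e f (fun s => beta_h_torsion s j)).
  by field; rewrite !J_neq0.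
have mu_gen i : mu (gen (sqm mm) i) = zeta (sqm mm i) ^+ X i j.
  have := etrans (esym (pres_act presW _ j)) (genB i j).
  move/(basis_scaleI (pres_basis presW)).
  by rewrite /mu => ->; field; rewrite !J_neq0.
have muE : mu g = root_char g j.
  rewrite (cyc_char_gen (sqm_gt0 mm_gt0) mu1 muM); apply: eq_bigr => i _.
  by rewrite mu_gen exprM.
rewrite /twisted_char -muE /mu.
by field; rewrite !J_neq0.
Qed.

End TwistedCharacters.

(** * Abelian cocycles *)

(** Both sides are the structure constants of the double for the basis elements
    e_g x and e_g y, in the two orders. *)
Lemma abelian_tilde (k : fieldType) (H : finGroupType) (Phi : H -> H -> H -> k) g x y :
  abelian_cocycle Phi -> commute x y -> tilde Phi g x y = tilde Phi g y x.
Proof.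
pose delta (p : H * H) : {ffun H * H -> k} := [ffun q => (q == p)%:R].
have mul_delta x' y' : tqd_mul Phi (delta (g, x')) (delta (g, y')) (g, x' * y')%g
    = tilde Phi g x' y'.
  rewrite ffunE (bigD1 x') //= (bigD1 y') //= !ffunE !eqxx !mulr1.
  rewrite !big1 ?addr0 // => [x1 neq_x|y1 /andP[_ neq_y]].
    rewrite big1 // => y1 _.
    by rewrite !ffunE xpair_eqE (negPf neq_x) andbF mulr0 mul0r.
  by rewrite !ffunE !xpair_eqE (negPf neq_y) andbF mulr0.
by move=> ab xy; rewrite -!mul_delta ab xy.
Qed.

Section AbelianCocycle.
Variables (k : fieldType) (zeta : nat -> k).
Hypothesis zetaP : compatible_roots zeta.
Variables (n : nat) (mm : 'I_n -> nat).
Hypothesis mm_gt0 : forall i, (0 < mm i)%N.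
Variable a : cocycle_seq n.

Let third_factor (p q r : 'I_n) : k :=
  \prod_(r' : 'I_n) \prod_(s' : 'I_n | (r' < s')%N) \prod_(t' : 'I_n | (s' < t')%N)
    zeta (gcdn (gcdn (mm r') (mm s')) (mm t'))
      ^- (a3 a r' s' t' * ((r' == r) %% mm r') * ((s' == q) %% mm s')
          * ((t' == p) %% mm t')).

Lemma Phi_gen (p q r : 'I_n) : q != r ->
  Phi_a zeta a (gen mm p) (gen mm q) (gen mm r) = third_factor p q r.
Proof.
move=> neq_qr.
have no_carry l : ((gen mm q l + gen mm r l) %/ mm l = 0)%N.
  rewrite !of_expsE //; have := mm_gt0 l; case: (mm l) => [//|[|m]] _.
    by rewrite !modn1.
  rewrite divn_small //; case: eqP => [->|_]; last by case: eqP.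
  by rewrite (negPf neq_qr).
rewrite /Phi_a big1 ?mul1r => [|l _]; last by rewrite no_carry muln0.
rewrite big1 ?mul1r => [|s _]; last by rewrite big1 // => t _; rewrite no_carry muln0.
apply: eq_bigr => r' _; apply: eq_bigr => s' _; apply: eq_bigr => t' _.
by rewrite !of_expsE.
Qed.

Lemma third_factor_sorted (r s t : 'I_n) : (r < s)%N -> (s < t)%N ->
  (1 < mm r)%N -> (1 < mm s)%N -> (1 < mm t)%N ->
  third_factor t s r = zeta (gcdn (gcdn (mm r) (mm s)) (mm t)) ^- a3 a r s t.
Proof.
move=> lt_rs lt_st mr ms mt; rewrite /third_factor (bigD1 r) //=.
rewrite (bigD1 s) //= (bigD1 t) //= !eqxx !modn_small // !muln1.
rewrite !big1 ?mulr1 // => [r' neq|s' /andP[_ neq]|t' /andP[_ neq]].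
- rewrite big1 // => s' _; rewrite big1 // => t' _.
  by rewrite (negPf neq) mod0n muln0 !mul0n invr1.
- by rewrite big1 // => t' _; rewrite (negPf neq) mod0n muln0 mul0n invr1.
- by rewrite (negPf neq) mod0n muln0 invr1.
Qed.

Lemma third_factor_unsorted (p q r : 'I_n) :
  ~~ (r < q < p)%N -> third_factor p q r = 1.
Proof.
move=> unsorted; rewrite /third_factor big1 // => r' _.
rewrite big1 // => s' lt_rs; rewrite big1 // => t' lt_st.
have [eq_r|_] := eqVneq r' r; last by rewrite mod0n muln0 !mul0n invr1.
have [eq_s|_] := eqVneq s' q; last by rewrite mod0n muln0 mul0n invr1.
have [eq_t|_] := eqVneq t' p; last by rewrite mod0n muln0 invr1.
by case/negP: unsorted; rewrite -eq_r -eq_s -eq_t lt_rs.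
Qed.

(** On generators there are no carries, so that only the third factor of the
    cocycle remains; of the six values that enter the commutation of e_{g_t} g_s
    with e_{g_t} g_r, only that of (g_t, g_s, g_r) can differ from 1. *)
Lemma a3_abelian : in_A mm a -> abelian_cocycle (Phi_a zeta (mm := mm) a) ->
  forall r s t : 'I_n, (r < s)%N -> (s < t)%N -> a3 a r s t = 0%N.
Proof.
move=> [_ _ a3_lt] ab r s t lt_rs lt_st.
have lt_rt := ltn_trans lt_rs lt_st.
have := a3_lt r s t lt_rs lt_st; set m := gcdn _ _ => lt_a3m.
have m_gt0 : (0 < m)%N by apply: leq_ltn_trans lt_a3m.
have [m_le1|m_gt1] := leqP m 1.
  by apply/eqP; rewrite -leqn0 -ltnS; apply: leq_trans m_le1.
have mm_gt1 l : (m %| mm l)%N -> (1 < mm l)%N.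
  by move=> dvd_ml; apply: leq_trans m_gt1 (dvdn_leq _ dvd_ml).
have dvd_m2 : (m %| gcdn (mm r) (mm s))%N by apply: dvdn_gcdl.
have mr : (1 < mm r)%N by apply: mm_gt1; apply: dvdn_trans dvd_m2 (dvdn_gcdl _ _).
have ms : (1 < mm s)%N by apply: mm_gt1; apply: dvdn_trans dvd_m2 (dvdn_gcdr _ _).
have mt : (1 < mm t)%N by apply: mm_gt1; apply: dvdn_gcdr.
have := abelian_tilde (gen mm t) ab (cycC mm_gt0 (gen mm s) (gen mm r)).
rewrite /tilde !Phi_gen; try by rewrite -val_eqE /=; lia.
rewrite (third_factor_sorted lt_rs lt_st) // !third_factor_unsorted; try lia.
rewrite -/m !(invr1, mulr1) => /(congr1 GRing.inv); rewrite invrK invr1 => /eqP.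
by rewrite -[1](expr0 (zeta m)) (zeta_eq zetaP) // mod0n modn_small // => /eqP->.
Qed.

End AbelianCocycle.

(** * The two directions *)

Section Correspondence.
Variables (k : fieldType) (zeta : nat -> k).
Hypothesis zetaP : compatible_roots zeta.
Variables (n : nat) (mm : 'I_n -> nat).
Hypothesis mm_gt0 : forall i, (0 < mm i)%N.
Hypothesis mm_dvd : forall i j : 'I_n, (i < j)%N -> (mm i %| mm j)%N.
Variable a : cocycle_seq n.

Lemma pi_surj : (pi_mor mm @* [set: cyc n (sqm mm)])%g = [set: cyc n mm].
Proof.
apply/eqP; rewrite eqEsubset subsetT; apply/subsetP => y _.
by apply/morphimP; exists (iota_sec y); rewrite ?inE //= iota_secK.
Qed.

Lemma morphim_pi_gen (I : finType) (h : I -> cyc n (sqm mm)) :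
  (pi_mor mm @* <<[set h j | j : I]>>)%g = <<[set pi_fun (h j) | j : I]>>%g.
Proof.
by rewrite morphim_gen ?subsetT // morphimEsub ?subsetT // -imset_comp.
Qed.

Section RootDatumToModule.
Variable D : root_datum zeta mm.
Hypothesis aD : associated_seq D a.

Let a3_eq0 := assoc_a3 aD.

Lemma seq_of_admissible T' : admissible mm (rd_S D) (rd_X D) T' -> forall i l : 'I_n,
  zeta (mm i) ^ (\sum_j (rd_X D i j)%:Z * T' l j) = zeta (mm l) ^+ beta_exp a i l.
Proof.
move=> admT' i l; apply/eqP; case: (ltngtP i l) => [lt_il|lt_li|/val_inj <-].
- by rewrite (beta_exp_gt zetaP mm_gt0 mm_dvd) // (assoc_a2 aD admT').
- by rewrite (beta_exp_lt zetaP mm_gt0) // (proj2 admT').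
- by rewrite (beta_exp_diag zetaP mm_gt0) // (assoc_a1 aD admT').
Qed.

Lemma root_datum_beta i j : zeta (mm i) ^+ rd_X D i j = beta zeta mm a i (rd_S D j).
Proof.
have [T admT] := rd_T D.
exact: (X_beta_of_T zetaP mm_gt0 admT seq_of_admissible).
Qed.

Let lam := twisted_char zeta (mm := mm) a (rd_S D) (rd_X D).

Lemma V_D_exists : exists W : yd_data k (cyc n (sqm mm)), is_V_D D a W.
Proof.
have [W [B presW]] := pres_exists (rd_h (D := D)) lam.
exists W; split.
  apply: (pres_YD presW) => [j|e f j]; first exact: twisted_char1.
  by apply: (twisted_charM zetaP mm_gt0 a3_eq0); apply: root_datum_beta.
exists B; split=> [|i j]; first exact: pres_canonical presW.
by rewrite (pres_act presW) /lam /twisted_char root_char_gen.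
Qed.

(** The scalars of W factor through pi, so the regraded space W serves as V. The
    cochain cancels in the products of opposite entries of the braiding matrix of
    the untwisted V, which therefore has the diagram of D. *)
Lemma V_D_descends (W : yd_data k (cyc n (sqm mm))) : is_V_D D a W ->
  exists V : yd_data k (cyc n mm),
    [/\ is_YD (Phi_a zeta a) V, is_diagonal V, nichols_arithmetic zeta a V
      & nichols_iso_through (pi_mor mm) (pi_Phi zeta a) W (Phi_a zeta a) V].
Proof.
case=> ydW [B [canB genB]].
have X_beta := root_datum_beta.
have presW : diag_pres (rd_h (D := D)) B lam by apply: pres_twisted.
have [lam1 lamM] := YD_pres presW ydW.
have lam_pi g j : lam (iota_sec (pi_fun g)) j = lam g j.
  by apply: (twisted_char_pi zetaP mm_gt0 X_beta); rewrite iota_secK.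
pose V := regrade (@pi_fun n mm) (@iota_sec n mm) W; exists V.
have presV : diag_pres (V := V) (fun j => pi_fun (rd_h (D := D) j)) B
    (fun g j => lam (iota_sec g) j).
  exact: pres_regrade.
have ydV : is_YD (Phi_a zeta a) V.
  apply: (pres_YD presV) => [j|e f j]; first by rewrite -(pi_1 mm_gt0) lam_pi.
  rewrite lamM tilde_pi_Phi // !iota_secK // tilde_Phi //.
  by rewrite -lam_pi pi_mulg !iota_secK.
have ydU : is_YD trivial_cocycle (untwist zeta a V).
  apply: (untwist_YD zetaP mm_gt0 a3_eq0 ydV presV) => s j.
  by rewrite beta_pi // (beta_h_torsion zetaP mm_gt0 X_beta).
have presU := pres_untwist zetaP mm_gt0 a presV.
have [T [TS _]] := rd_T D.
have hW : <<[set rd_h (D := D) j | j : 'I_(rd_rank D)]>>%g = [set: cyc n (sqm mm)].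
  by rewrite -(exps_generate (sqm_gt0 mm_gt0) TS).
split=> //.
- exists (rd_rank D), (fun j => pi_fun (rd_h (D := D) j)), B.
  exact: pres_canonical presV.
- split=> //; pose h' j := iota_sec (pi_fun (rd_h (D := D) j)).
  exists (rd_rank D), h', B, (fun i j => lam (rd_h (D := D) i) j).
  split=> [|i j|]; first exact: pres_canonical presU.
    by rewrite (pres_act presU) J_section // mul1r iota_secK // lam_pi.
  have [chi [E [arE eqD]]] := rd_arithmetic D.
  have lamE i j : lam (rd_h (D := D) i) j * lam (rd_h (D := D) j) i
      = root_char zeta (mm := mm) (rd_X D) (rd_h (D := D) i) j
        * root_char zeta (mm := mm) (rd_X D) (rd_h (D := D) j) i.
    by rewrite /lam /twisted_char /rd_h; field; rewrite !J_neq0.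
  apply: arithmetic_of_diagram arE; rewrite ?unitmx1 //.
    by apply: bichar_of_matrixP => i j; apply: twisted_char_neq0.
  rewrite -eqD; split=> [i|i j neq_ij].
    rewrite rd_vertex /= bichar_of_matrix_basis /lam /twisted_char /rd_h.
    by rewrite divff ?J_neq0 // mulr1 root_char_of_exps.
  rewrite rd_edge // edge_const_dynkin // !bichar_of_matrix_basis lamE /rd_h.
  rewrite !root_char_of_exps // -big_split; apply: eq_bigr => l _ /=.
  by rewrite exprD.
- split=> //=.
  + by rewrite -hW; apply: (pres_support presW).
  + have := morphim_pi_gen (rd_h (D := D)); rewrite hW => ->.
    exact: (pres_support presV).
  exists \1%VF; split=> [|y v|g v _].
  + by exists id => v; rewrite lfunE.
  + rewrite lfunE /= sum_lfunE; apply: eq_big => [x|x _]; last by rewrite lfunE.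
    by rewrite inE.
  + rewrite !lfunE /=; move: v; apply: (basis_lin_ind (pres_basis presW)).
    * by rewrite !linear0.
    * by move=> c u v IHu IHv; rewrite !linearP /= IHu IHv.
    * by move=> j; rewrite !(pres_act presW) lam_pi.
Qed.

End RootDatumToModule.

Section ModuleToRootDatum.
Hypothesis aA : in_A mm a.

Lemma beta_trivial_factor s x : mm s = 1%N -> beta zeta mm a s x = 1.
Proof.
case: aA => a1_lt a2_lt _ mm1; rewrite betaE.
have -> : a1 a s = 0%N by apply/eqP; rewrite -leqn0 -ltnS -mm1.
rewrite mul0n expr0 mul1r big1 // => t lt_st.
have -> : a2 a s t = 0%N.
  by apply/eqP; rewrite -leqn0 -ltnS -(gcd1n (mm t)) -mm1 a2_lt.
by rewrite mul0n expr0.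
Qed.

(** The quotients of the exponents of g i ^ mm i are 1 at i and 0 elsewhere, except
    that they all vanish if mm i = 1; in that case beta i is trivial. *)
Lemma J_kernel_gen (h : cyc n (sqm mm)) i :
  J_a zeta a h (gen (sqm mm) i ^+ mm i)%g = beta zeta mm a i (fun t => h t).
Proof.
have sq_gt0 := sqm_gt0 mm_gt0.
rewrite J_betaE // (bigD1 i) //= big1 => [|s neq_si]; last first.
  by rewrite cycX // of_expsE // (negPf neq_si) mod0n muln0 mod0n div0n expr0.
rewrite mulr1; have [mm1|mm_gt1] := leqP (mm i) 1.
  have mm_i1 : mm i = 1%N by apply/eqP; rewrite eqn_leq mm1 mm_gt0.
  by rewrite beta_trivial_factor ?expr1n.
rewrite cycX // of_expsE // eqxx modnMmr muln1 modn_small ?divnn ?mm_gt0 ?expr1 //.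
by rewrite /sqm -mulnn ltn_Pmulr.
Qed.

Hypothesis a3_eq0 :
  forall r s t : 'I_n, (r < s)%N -> (s < t)%N -> a3 a r s t = 0%N.

(** The untwisted scalars mu are characters, and pi kills g i ^ mm i. So this
    element acts on the j-th basis vector by J_a (h j) (g i ^ mm i) = beta i (h j);
    it also acts by the power mm i of zeta (sqm mm i) ^ X i j. *)
Lemma root_datum_of_module (V : yd_data k (cyc n mm)) :
  is_YD (Phi_a zeta a) V -> nichols_arithmetic zeta a V ->
  is_support V [set: cyc n mm] ->
  exists (D : root_datum zeta mm) (W : yd_data k (cyc n (sqm mm))),
    [/\ associated_seq D a, is_V_D D a W
      & nichols_iso_through (pi_mor mm) (pi_Phi zeta a) W (Phi_a zeta a) V].
Proof.
move=> ydV [ydU [d [h [B [q [canU actU arU]]]]]] suppV.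
have sq_gt0 := sqm_gt0 mm_gt0.
have [hK canV] := canonical_of_untwist zetaP mm_gt0 ydU canU.
have [lam presV] : exists lam, diag_pres (V := V) (fun j => pi_fun (h j)) B lam.
  by eexists; apply: canonical_pres ydV canV.
pose mu g j := J_a zeta a (h j) g * lam (pi_fun g) j.
have presU : diag_pres (V := untwist zeta a V) h B mu.
  apply: (pres_ext _ _ (pres_untwist zetaP mm_gt0 a presV)) => // g j.
  by rewrite hK.
have presW : diag_pres (V := lift_yd V) h B (fun g j => lam (pi_fun g) j).
  by apply: (pres_ext _ _ (pres_lift presV)).
have [lam1 lamM] := YD_pres presV ydV.
have [mu1 muM'] := YD_pres presU ydU.
have muM j e f : mu (e * f)%g j = mu e j * mu f j.
  by rewrite muM' tilde_trivial mul1r.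
have muX j e m : mu (e ^+ m)%g j = mu e j ^+ m.
  by elim: m => [|m IHm]; rewrite ?expg0 ?mu1 // expgS exprS muM IHm.
have muE j g : mu g j = \prod_i mu (gen (sqm mm) i) j ^+ g i.
  exact: (cyc_char_gen sq_gt0 (mu1 j) (muM j)).
have rootP i j : {x : 'I_(sqm mm i) | mu (gen (sqm mm) i) j = zeta (sqm mm i) ^+ x}.
  apply: (prim_rootP (proj1 zetaP _ (sq_gt0 i))); rewrite -muX -(mu1 j).
  congr (mu _ j); apply: cyc_ext => t; rewrite cycX // cyc1 of_expsE //.
  by case: eqP => [->|_]; rewrite ?mod0n ?muln0 ?mod0n // modnMr.
pose S : 'M[nat]_(d, n) := \matrix_(i, l) (h i l : nat).
pose X : 'M[nat]_(n, d) := \matrix_(i, j) (sval (rootP i j) : nat).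
have muX_gen i j : mu (gen (sqm mm) i) j = zeta (sqm mm i) ^+ X i j.
  by rewrite mxE; case: (rootP i j).
have SE j : of_exps (sqm mm) (S j) = h j.
  apply: cyc_ext => l; rewrite of_expsE // mxE modn_small //.
  exact: cyc_ltn.
have X_beta i j : zeta (mm i) ^+ X i j = beta zeta mm a i (S j).
  have -> : beta zeta mm a i (S j) = beta zeta mm a i (fun t => h j t).
    by apply: eq_bigr => t _; rewrite mxE.
  rewrite -J_kernel_gen -[LHS](zeta_expM zetaP _ (mm_gt0 i) (mm_gt0 i)) mulnn.
  rewrite mulnC exprM -muX_gen -muX /mu.
  suff -> : pi_fun (gen (sqm mm) i ^+ mm i)%g = 1%g by rewrite lam1 mulr1.
  apply: cyc_ext => t; rewrite pi_funE // cycX // cyc1 of_expsE //.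
  case: eqP => [->|_]; last by rewrite mod0n muln0 !mod0n.
  by rewrite modn_dvdm ?dvdn_exp // modnMr.
have gen_h : <<[set h j | j : 'I_d]>>%g = [set: cyc n (sqm mm)].
  apply: (lift_generates mm_gt0) => y.
  have : y \in (pi_mor mm @* <<[set h j | j : 'I_d]>>)%g.
    by rewrite morphim_pi_gen (support_unique ydV presV suppV) inE.
  by case/morphimP => x _ Kx ->; exists x.
have [T TS] : exists T : 'M[int]_(n, d), forall j l,
    (\sum_i T j i * (S i l)%:Z == (j == l)%:Z %[mod (sqm mm l)%:Z])%Z.
  have rowT i : exists t : 'I_d -> int, forall l,
      (\sum_j t j * (S j l)%:Z = (gen (sqm mm) i l : nat)%:Z %[mod (sqm mm l)%:Z])%Z.
    apply: (generated_exps sq_gt0).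
    have -> : [set of_exps (sqm mm) (S j) | j : 'I_d] = [set h j | j : 'I_d].
      exact: eq_imset.
    by rewrite gen_h inE.
  have [t tE] := fin_all_exists rowT.
  exists (\matrix_(i, j) t i j) => j l; under eq_bigr do rewrite mxE.
  by rewrite tE of_expsE // -modz_nat modz_mod [l == j]eq_sym.
have seqT (T' : 'M[int]_(n, d)) : (forall j l,
    (\sum_i T' j i * (S i l)%:Z == (j == l)%:Z %[mod (sqm mm l)%:Z])%Z) ->
    forall i l, zeta (mm i) ^ (\sum_j (X i j)%:Z * T' l j)
                = zeta (mm l) ^+ beta_exp a i l.
  exact: (beta_exp_of_T zetaP mm_gt0 X_beta).
have qE i j : q i j = mu (h i) j.
  apply: (basis_scaleI (j := j) (pres_basis presU)).
  by rewrite -(pres_act presU) -actU.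
have qX i j : q i j = \prod_l zeta (sqm mm l) ^+ (S i l * X l j).
  rewrite qE muE; apply: eq_bigr => l _.
  by rewrite muX_gen -exprM mulnC [S i l]mxE.
have S_lt i j : (S i j < sqm mm j)%N by rewrite mxE cyc_ltn.
have X_lt i j : (X i j < sqm mm i)%N by rewrite mxE.
have admT : admissible mm S X T.
  by split=> // l i lt_li; rewrite -(beta_exp_lt zetaP mm_gt0 a _ lt_li) seqT.
have vertE i : vertex_label (dynkin_diagram (bichar_of_matrix q) 1%:M) i
    = \prod_l zeta (sqm mm l) ^+ (S i l * X l i).
  by rewrite /= bichar_of_matrix_basis qX.
have edgeE i j : i != j ->
    edge_const (dynkin_diagram (bichar_of_matrix q) 1%:M) i j
    = \prod_l zeta (sqm mm l) ^+ (S i l * X l j + S j l * X l i).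
  move=> neq_ij; rewrite edge_const_dynkin // !bichar_of_matrix_basis !qX.
  by rewrite -big_split; apply: eq_bigr => l _; rewrite exprD.
pose D : root_datum zeta mm := RootDatum
  (ex_intro _ _ (ex_intro _ _ (conj arU (erefl _)))) S_lt X_lt
  (ex_intro _ T admT) vertE edgeE.
exists D, (lift_yd V); split.
- split=> // T' [TS' _] i => [|l lt_il].
  + by rewrite -(beta_exp_diag zetaP mm_gt0) seqT.
  + by rewrite -(beta_exp_gt zetaP mm_gt0 mm_dvd a _ lt_il) seqT.
- split.
    apply: (pres_YD presW) => [j|e f j]; first by rewrite pi_1 // lam1.
    by rewrite lamM tilde_Phi // tilde_pi_Phi // pi_mulg.
  exists B; split.
    apply: (pres_canonical (lam := fun g j => lam (pi_fun g) j)).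
    exact: pres_ext (fun j => esym (SE j)) (fun _ _ => erefl _) presW.
  move=> i j; rewrite (pres_act presW) /rd_h /= SE -muX_gen /mu.
  rewrite -{2}hK J_section //.
  by congr (_ *: _); field; apply: J_neq0.
- split=> //=.
  + by rewrite -gen_h; apply: (pres_support presW).
  + by rewrite pi_surj.
  exists \1%VF; split=> [|y v|g v _].
  + by exists id => v; rewrite lfunE.
  + rewrite lfunE (bigD1 (iota_sec y)) /=; last by rewrite inE iota_secK /=.
    rewrite [X in X + _]lfunE /= (big_pred1 y) => [|x]; last first.
      by rewrite /= (can_eq (iota_secK mm_gt0)).
    rewrite big1 ?addr0 // => x /andP[/andP[_ /eqP pi_x] neq_x].
    rewrite lfunE /= big_pred0 ?lfunE // => z.
    by apply: contraNF neq_x => /eqP zx; rewrite -pi_x /= -zx iota_secK.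
  + by rewrite !lfunE.
Qed.

End ModuleToRootDatum.

End Correspondence.

Theorem theorem4p14 (k : closedFieldType) (k_char0 : [pchar k] =i pred0)
    (zeta : nat -> k) (zetaP : compatible_roots zeta)
    (n : nat) (mm : 'I_n -> nat) (mm_gt0 : forall i, (0 < mm i)%N)
    (mm_dvd : forall i j : 'I_n, (i < j)%N -> (mm i %| mm j)%N) :
  (forall (D : root_datum zeta mm) (a : cocycle_seq n), associated_seq D a ->
     (exists W : yd_data k (cyc n (sqm mm)), is_V_D D a W) /\
     (forall W : yd_data k (cyc n (sqm mm)), is_V_D D a W ->
        exists V : yd_data k (cyc n mm),
          [/\ is_YD (Phi_a zeta a) V, is_diagonal V, nichols_arithmetic zeta a V
            & nichols_iso_through (pi_mor mm) (pi_Phi zeta a) W (Phi_a zeta a) V]))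
  /\
  (forall (a : cocycle_seq n) (V : yd_data k (cyc n mm)),
     in_A mm a -> abelian_cocycle (Phi_a zeta (mm := mm) a) ->
     is_YD (Phi_a zeta a) V -> is_diagonal V -> nichols_arithmetic zeta a V ->
     is_support V [set: cyc n mm] ->
     exists (D : root_datum zeta mm) (W : yd_data k (cyc n (sqm mm))),
       [/\ associated_seq D a, is_V_D D a W
         & nichols_iso_through (pi_mor mm) (pi_Phi zeta a) W (Phi_a zeta a) V]).
Proof.
split=> [D a aD|a V aA ab ydV _ arV suppV].
  split; first exact: V_D_exists.
  by move=> W; apply: V_D_descends.
by apply: root_datum_of_module => //; apply: (a3_abelian zetaP).
Qed.
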